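(* Let $T$ be a complete first-order theory. If $T$ is N-$\omega$-DCTP$_2$, then Kim-dividing and Kim-forking are equivalent over models; that is, for every model $M$ of $T$, a formula with parameters Kim-forks over $M$ if and only if it Kim-divides over $M$.
   Context: $T$ is a complete first-order $\mathcal{L}$-theory with monster model $\mathbb{M}$; tuples and small sets live in $\mathbb{M}$ and models $M$ are small elementary submodels of $\mathbb{M}$. A global type is a complete type over $\mathbb{M}$. Formulas $\varphi(x,y)$ may use parameters from the base. On $2^{<\omega}$: $\eta\wedge\nu$ is the longest common initial segment; $\eta<_{lex}\nu$ if $\eta\subsetneq\nu$, or $\eta,\nu$ are $\subseteq$-incomparable and $\eta(l)<\nu(l)$ at the first place $l$ where they differ. An antichain $\{\eta_0,\dots,\eta_n\}\subseteq 2^{<\omega}$ (pairwise incomparable elements) with $\eta_0<_{lex}\cdots<_{lex}\eta_n$ is a descending comb if $\eta_i\wedge\eta_k=\eta_j\wedge\eta_k$ for all $i<j<k\le n$. For $k<\omega$, an $\mathcal{L}$-formula $\varphi(x,y)$ has $k$-DCTP$_2$ if there is $(a_\eta)_{\eta\in2^{<\omega}}$ such that $\{\varphi(x,a_\eta)\}_{\eta\in X}$ is consistent for each descending comb $X\subseteq2^{<\omega}$, and $\{\varphi(x,a_{\eta|_i})\}_{i<\omega}$ is $k$-inconsistent (every $k$-element subset is inconsistent) for each $\eta\in2^\omega$. $T$ is N-$\omega$-DCTP$_2$ if for no $k<\omega$ does any formula have $k$-DCTP$_2$. A global type $p(x)$ is invariant over $M$ if $\varphi(x,b)\in p\Leftrightarrow\varphi(x,b')\in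 p$ whenever $b\equiv_M b'$. An invariant Morley sequence in $\mathrm{tp}(a/M)$ is a sequence $(a_i)_{i<\omega}$ for which there is a global $M$-invariant type $p\supseteq\mathrm{tp}(a/M)$ with $a_i\models p|_{Ma_{<i}}$ for all $i$. $\varphi(x,a)$ Kim-divides over $M$ if there is an invariant Morley sequence $(a_i)_{i<\omega}$ in $\mathrm{tp}(a/M)$ such that $\{\varphi(x,a_i)\}_{i<\omega}$ is inconsistent. A formula Kim-forks over $M$ if it implies a finite disjunction of formulas with parameters, each of which Kim-divides over $M$. *)

(* Defs.v *)
From mathcomp Require Import all_boot.
From mathcomp Require Import boolp classical_sets functions cardinality.

Set Implicit Arguments.
Unset Strict Implicit.
Unset Printing Implicit Defensive.

Local Open Scope classical_set_scope.
Local Open Scope card_scope.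

Definition copair (U V X : Type) (f : U -> X) (g : V -> X) (w : U + V) : X :=
  match w with inl u => f u | inr v => g v end.

Definition card_lt (U V : Type) (A : set U) (B : set V) : Prop :=
  A #<= B /\ ~ (B #<= A).

(** * First-order logic *)

Record language := Language {
  fsym : Type; farity : fsym -> nat;
  rsym : Type; rarity : rsym -> nat }.

(* [V] is the type of the free variables.  A formula with parameters from [A]
   in the variables [V] is an element of [formula L (V + A)], the elements of
   [A] playing the role of constants. *)
Inductive term (L : language) (V : Type) : Type :=
| Var of V
| App (f : fsym L) of ('I_(farity f) -> term L V).

Arguments Var {L V} _.
Arguments App {L V} f _.

(* In [All phi] the bound variable is the [None] of [option V]. *)
Inductive formula (L : language) (V : Type) : Type :=
| Bot
| Eq of term L V & term L V
| Rel (r : rsym L) of ('I_(rarity r) -> term L V)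
| Imp of formula L V & formula L V
| All of formula L (option V).

Arguments Bot {L V}.
Arguments Eq {L V} _ _.
Arguments Rel {L V} r _.
Arguments Imp {L V} _ _.
Arguments All {L V} _.

Definition Not (L : language) (V : Type) (phi : formula L V) : formula L V :=
  Imp phi Bot.

Fixpoint trename (L : language) (V W : Type) (s : V -> W) (t : term L V) :
    term L W :=
  match t with
  | Var v => Var (s v)
  | App f ts => App f (fun i => trename s (ts i))
  end.

Fixpoint rename (L : language) (V W : Type) (s : V -> W) (phi : formula L V) :
    formula L W :=
  match phi with
  | Bot => Bot
  | Eq t u => Eq (trename s t) (trename s u)
  | Rel r ts => Rel r (fun i => trename s (ts i))
  | Imp phi1 phi2 => Imp (rename s phi1) (rename s phi2)
  | All phi1 => All (rename (omap s) phi1)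
  end.

Record structure (L : language) := Structure {
  dom :> Type;
  point_dom : inhabited dom;
  fint : forall f : fsym L, ('I_(farity f) -> dom) -> dom;
  rint : forall r : rsym L, ('I_(rarity r) -> dom) -> Prop }.

Arguments fint {L} s f _.
Arguments rint {L} s r _.

Fixpoint eval (L : language) (M : structure L) (V : Type) (e : V -> M)
    (t : term L V) : M :=
  match t with
  | Var v => e v
  | App f ts => fint M f (fun i => eval e (ts i))
  end.

Fixpoint sat (L : language) (M : structure L) (V : Type) (e : V -> M)
    (phi : formula L V) : Prop :=
  match phi with
  | Bot => False
  | Eq t u => eval e t = eval e u
  | Rel r ts => rint M r (fun i => eval e (ts i))
  | Imp phi1 phi2 => sat e phi1 -> sat e phi2
  | All phi1 => forall x : M, sat (oapp e x) phi1
  end.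

Definition theory (L : language) : Type := set (formula L void).

Definition models (L : language) (M : structure L) (T : theory L) : Prop :=
  forall sigma, T sigma -> sat (of_void M) sigma.

Definition entails (L : language) (T : theory L) (sigma : formula L void) :
    Prop :=
  forall N : structure L, models N T -> sat (of_void N) sigma.

Definition complete_theory (L : language) (T : theory L) : Prop :=
  (exists N : structure L, models N T) /\
  forall sigma, entails T sigma \/ entails T (Not sigma).

Definition elementary (L : language) (N M : structure L) (h : N -> M) : Prop :=
  forall n (phi : formula L 'I_n) (v : 'I_n -> N),
    sat v phi <-> sat (h \o v) phi.

Section Substructure.
Variables (L : language) (M : structure L) (A : set M).

Definition fclosed_set : Prop :=
  forall (f : fsym L) (v : 'I_(farity f) -> M),
    (forall i, A (v i)) -> A (fint M f v).

Hypotheses (A0 : inhabited A) (Af : fclosed_set).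

Definition substructure : structure L :=
  @Structure L A A0
    (fun f v => SigSub (mem_set (@Af f (val \o v) (fun i => set_valP (v i)))))
    (fun r v => rint M r (val \o v)).

End Substructure.

Definition elementary_submodel (L : language) (M : structure L) (A : set M) :
    Prop :=
  exists (A0 : inhabited A) (Af : fclosed_set A),
    elementary (val : substructure A0 Af -> M).

Definition automorphism (L : language) (M : structure L) (s : M -> M) : Prop :=
  [/\ bijective s,
      forall f v, s (fint M f v) = fint M f (s \o v)
    & forall r v, rint M r v <-> rint M r (s \o v)].

(** * Types *)

Section Types.
Variables (L : language) (M : structure L).

(* The formula phi(x, b) with parameters in [M], for phi(x, w) and b : W -> M *)
Definition inst n (W : Type) (phi : formula L ('I_n + W)) (b : W -> M) :
    formula L ('I_n + M) :=
  rename (copair inl (inr \o b)) phi.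

(* Consistency with the elementary diagram of [M], i.e. finite satisfiability
   in [M]; in a monster model a small consistent set is then realized. *)
Definition consistent n (p : set (formula L ('I_n + M))) : Prop :=
  forall F, finite_set F -> F `<=` p ->
    exists c : 'I_n -> M, forall phi, F phi -> sat (copair c id) phi.

Definition realizes n (A : set M) (c : 'I_n -> M)
    (q : set (formula L ('I_n + A))) : Prop :=
  forall phi, q phi -> sat (copair c val) phi.

Definition tp n (a : 'I_n -> M) (A : set M) : set (formula L ('I_n + A)) :=
  [set phi | sat (copair a val) phi].
Arguments tp {n} a A _.

Definition global_type n (p : set (formula L ('I_n + M))) : Prop :=
  consistent p /\ forall phi, p phi \/ p (Not phi).

Definition restrict n (p : set (formula L ('I_n + M))) (A : set M) :
    set (formula L ('I_n + A)) :=
  [set phi | p (inst phi val)].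
Arguments restrict {n} p A _.

Definition invariant n (A : set M) (p : set (formula L ('I_n + M))) : Prop :=
  forall m (phi : formula L ('I_n + ('I_m + A))) (b b' : 'I_m -> M),
    tp b A = tp b' A ->
    p (inst phi (copair b val)) <-> p (inst phi (copair b' val)).

Definition invariant_morley n (A : set M) (a : 'I_n -> M)
    (s : nat -> 'I_n -> M) : Prop :=
  exists p : set (formula L ('I_n + M)),
    [/\ global_type p, invariant A p, tp a A `<=` restrict p A
      & forall i, realizes (s i)
          (restrict p (A `|` [set s jl.1 jl.2 | jl in [set jl | jl.1 < i]]))].

End Types.

(** * Monster models *)

(* [K] stands for the cardinal kappa of the monster model; small means of
   cardinality less than kappa. *)
Definition small (K : Type) (M : Type) (A : set M) : Prop :=
  card_lt A [set: K].

Definition uncountable_strong_limit (K : Type) : Prop :=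
  card_lt [set: nat] [set: K] /\
  forall A : set K, small K A -> small K [set B : set K | B `<=` A].

Definition saturated (K : Type) (L : language) (M : structure L) : Prop :=
  forall (A : set M) n (q : set (formula L ('I_n + A))),
    small K A -> consistent [set inst phi val | phi in q] ->
    exists c, realizes c q.

Definition strongly_homogeneous (K : Type) (L : language) (M : structure L) :
    Prop :=
  forall (A : set M) (f : M -> M), small K A ->
    (forall n (phi : formula L 'I_n) (v : 'I_n -> M),
       (forall i, A (v i)) -> (sat v phi <-> sat (f \o v) phi)) ->
    exists s, automorphism s /\ forall x, A x -> s x = f x.

Definition monster (K : Type) (L : language) (T : theory L) (M : structure L) :
    Prop :=
  [/\ uncountable_strong_limit K,
      small K [set: fsym L] /\ small K [set: rsym L],
      models M T, saturated K M & strongly_homogeneous K M].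

(** * Kim-dividing and Kim-forking *)

Section Kim.
Variables (L : language) (M : structure L).

(* phi(x, a) with phi(x, y) over [A], x an n-tuple and a a finite tuple *)
Record pformula (A : set M) (n : nat) := PFormula {
  pf_arity : nat;
  pf_form : formula L ('I_n + ('I_pf_arity + A));
  pf_tuple : 'I_pf_arity -> M }.

Definition psat (A : set M) n (c : 'I_n -> M) (phi : pformula A n) : Prop :=
  sat (copair c (copair (@pf_tuple A n phi) val)) (pf_form phi).

Definition Kim_divides (A : set M) n (phi : pformula A n) : Prop :=
  exists s : nat -> 'I_(pf_arity phi) -> M,
    invariant_morley A (@pf_tuple A n phi) s /\
    ~ consistent (range (fun i => inst (pf_form phi) (copair (s i) val))).

Definition Kim_forks (A : set M) n (phi : pformula A n) : Prop :=
  exists d (psi : 'I_d -> pformula A n),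
    (forall c, psat c phi -> exists i, psat c (psi i)) /\
    forall i, Kim_divides (psi i).

End Kim.

(** * The tree property DCTP2, on the tree [seq bool] of finite binary words *)

Fixpoint wmeet (eta nu : seq bool) : seq bool :=
  match eta, nu with
  | b :: eta', c :: nu' => if b == c then b :: wmeet eta' nu' else [::]
  | _, _ => [::]
  end.

Definition incomparable (eta nu : seq bool) : bool :=
  ~~ prefix eta nu && ~~ prefix nu eta.

Definition wlex (eta nu : seq bool) : bool :=
  (prefix eta nu && (eta != nu)) ||
  (incomparable eta nu &&
   let l := size (wmeet eta nu) in nth false eta l < nth false nu l).

Definition descending_comb n (c : 'I_n.+1 -> seq bool) : Prop :=
  [/\ forall i j, i != j -> incomparable (c i) (c j),
      forall i j : 'I_n.+1, i < j -> wlex (c i) (c j)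
    & forall i j k : 'I_n.+1, i < j -> j < k ->
        wmeet (c i) (c k) = wmeet (c j) (c k)].

Section DCTP2.
Variables (L : language) (M : structure L).

(* The family is indexed: distinct indices count as distinct members even when
   the formulas coincide. *)
Definition k_inconsistent k n (f : nat -> formula L ('I_n + M)) : Prop :=
  forall j : 'I_k -> nat, injective j -> ~ consistent (range (f \o j)).

Definition has_DCTP2 k n m (phi : formula L ('I_n + 'I_m)) : Prop :=
  exists a : seq bool -> 'I_m -> M,
    (forall r (c : 'I_r.+1 -> seq bool), descending_comb c ->
       consistent (range (fun i => inst phi (a (c i))))) /\
    forall eta : nat -> bool,
      k_inconsistent k (fun i => inst phi (a (mkseq eta i))).

(* For [M] a monster model of T, this says that T is N-omega-DCTP2. *)
Definition N_omega_DCTP2 : Prop :=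
  forall k n m (phi : formula L ('I_n + 'I_m)), ~ has_DCTP2 k phi.

End DCTP2.

(* Main.v *)
Require Import Defs.
From mathcomp Require Import all_boot.
From mathcomp Require Import boolp classical_sets functions cardinality filter.

Set Implicit Arguments.
Unset Strict Implicit.
Unset Printing Implicit Defensive.

Local Open Scope classical_set_scope.
Local Open Scope card_scope.

(** Write [f] for the maps from the monster model [MM] to [M] that fix [M]
pointwise.  Let [U] be an ultrafilter on these maps such that, whenever [phi(A)]
is true in [MM], [phi(f(A))] is true for [U]-almost all [f].  It chooses a global
coheir for every tuple at once: for a tuple [A] the formulas [phi(y, e)] such that
[phi(f(A), e)] holds for [U]-almost all [f] form a global type that extends
tp(A/M) and is finitely satisfiable in [M], hence [M]-invariant ([coheir]).  The
automorphisms of [MM] over [M] act on such ultrafilters by composition.  The proof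
fixes a minimal flow of this action, coded by a maximal invariant filter [F], and
an ultrafilter [U0] that refines [F].

The main point ([coheir_witness]) is that the coheirs given by [U0] witness all
Kim-dividing: if [psi(x, b)] divides along Morley sequences of some [M]-invariant
type [r] that extends tp(b/M), then it divides along Morley sequences of
[q := coheir U0 b].  Otherwise [psi] is consistent along the latter and
[k]-inconsistent along the former, for some [k], and DCTP2 follows from finite
trees of realizations of tp(b/M) in which every path, read from the top down, is
a Morley sequence of [r], and every descending comb is a Morley sequence of [q]
([good_tree_exists]).  A tree grows from a tree [A] by adding a second copy [A1]
of [A], placed to its right, that realizes a coheir of [A] over [A], and then a
root that realizes [r] over both copies.  For the combs to be Morley sequences of
[q], each vertex of [A1] has to realize [q] over [A]; so, at each step, some
ultrafilter of the flow must give all vertices of the tree the same coheir [q].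

That such ultrafilters persist is where minimality enters ([amalgamation]).  Let
[U] refine [F], let [A] be a tuple, and let [c] have the type of a part of [A]
and be independent from [A], in the sense that [c] realizes an invariant type
over [A].  If no ultrafilter of the flow gave [A] the coheir it has in [U], and
[c] the coheir of the corresponding part of [A], then some set [D] in the coheir
of [A] would be such that, in the flow, [A] lies in [D] only when [c] is off it.
By minimality, finitely many conjugates [A_i] of [A] are such that at every point
of the flow one of them lies in [D].  A conjugate [A'] of [A], the part of which
is independent from all [A_i], then never lies in [D]; by invariance neither does
[A], a contradiction.

Finally ([Kim_forks_divides]), suppose that [phi(x, a)] implies a disjunction of
formulas [psi_i(x, b_i)], each of which Kim-divides over [M].  All [psi_i] divide
along [coheir U0 b_i], thus along the corresponding part of a Morley sequence of
[coheir U0 (a, b_1, .., b_d)].  If [phi] were consistent along this sequence, a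
solution would satisfy the same [psi_i] at more places of it than the inconsistency
of [psi_i] allows. *)

(** * Formulas and substitution of variables *)

Lemma comp_copair (U V X Y : Type) (h : X -> Y) (f : U -> X) (g : V -> X) :
  h \o copair f g = copair (h \o f) (h \o g).
Proof. by apply/funext => -[]. Qed.

Section Syntax.
Variable L : language.
Implicit Type M : structure L.

Lemma trename_comp (U V W : Type) (s : U -> V) (s' : V -> W) (t : term L U) :
  trename s' (trename s t) = trename (s' \o s) t.
Proof.
by elim: t => [//|f ts IH] /=; congr App; apply/funext => i; apply: IH.
Qed.

Lemma rename_comp (U V W : Type) (s : U -> V) (s' : V -> W)
    (phi : formula L U) : rename s' (rename s phi) = rename (s' \o s) phi.
Proof.
elim: phi V W s s' => {U} /=.
- by [].
- by move=> U t u V W s s'; rewrite !trename_comp.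
- move=> U r ts V W s s'; congr Rel.
  by apply/funext => i; rewrite trename_comp.
- by move=> U p1 IH1 p2 IH2 V W s s'; rewrite IH1 IH2.
- move=> U p IH V W s s'; rewrite IH; congr All; congr rename.
  by apply/funext => -[].
Qed.

Lemma eval_trename M (V W : Type) (s : V -> W) (e : W -> M) (t : term L V) :
  eval e (trename s t) = eval (e \o s) t.
Proof.
by elim: t => [//|f ts IH] /=; congr (fint M f); apply/funext => i; apply: IH.
Qed.

Lemma sat_rename M (V W : Type) (s : V -> W) (e : W -> M) (phi : formula L V) :
  sat e (rename s phi) = sat (e \o s) phi.
Proof.
elim: phi W s e => {V} /=.
- by [].
- by move=> V t u W s e; rewrite !eval_trename.
- move=> V r ts W s e; congr (rint M r).
  by apply/funext => i; rewrite eval_trename.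
- by move=> V p1 IH1 p2 IH2 W s e; rewrite IH1 IH2.
- move=> V p IH W s e; apply: eq_forall => x; rewrite IH; congr sat.
  by apply/funext => -[].
Qed.

(** The finitely many variables of all the terms form a sum of ordinals. *)
Lemma family_support (I : finType) (V : Type) (ts : I -> term L V) :
  (forall i, exists n (v : 'I_n -> V) (u : term L 'I_n),
     ts i = trename v u) ->
  exists n (v : 'I_n -> V) (us : I -> term L 'I_n),
    ts = fun i => trename v (us i).
Proof.
move=> IH.
pose n i := projT1 (cid (IH i)).
pose v i : 'I_(n i) -> V := projT1 (cid (projT2 (cid (IH i)))).
pose C i := cid (projT2 (cid (projT2 (cid (IH i))))).
pose u i : term L 'I_(n i) := projT1 (C i).
have Hu i : ts i = trename (v i) (u i) := projT2 (C i).
pose J := {i : I & 'I_(n i)}.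
exists #|{: J}|, (fun k => v (tag (enum_val k)) (tagged (enum_val k))).
exists (fun i =>
  trename (fun j => enum_rank (Tagged (fun i => 'I_(n i)) j : J)) (u i)).
apply/funext => i; rewrite trename_comp Hu; congr trename.
by apply/funext => j /=; rewrite enum_rankK.
Qed.

Lemma trename_support (V : Type) (t : term L V) :
  exists n (v : 'I_n -> V) (u : term L 'I_n), t = trename v u.
Proof.
elim: t => [x|f ts /family_support[n [v [us ->]]]].
  by exists 1, (fun=> x), (Var ord0).
by exists n, v, (App f us).
Qed.

(** As a formula mentions finitely many variables, many facts on types in
    finitely many variables and parameters extend to arbitrary ones. *)
Lemma rename_support (V : Type) (phi : formula L V) :
  exists n (v : 'I_n -> V) (psi : formula L 'I_n), phi = rename v psi.
Proof.
elim: phi => {V} V.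
- by exists 0, (fun i : 'I_0 => match notF (ltn_ord i) with end), Bot.
- move=> t t'; have [n [v [u ->]]] := trename_support t.
  have [n' [v' [u' ->]]] := trename_support t'.
  exists (n + n'), (fun i : 'I_(n + n') => copair v v' (fintype.split i)).
  exists (Eq (trename (@lshift n n') u) (trename (@rshift n n') u')).
  rewrite /= !trename_comp; congr Eq; congr trename; apply/funext => i /=.
    by rewrite -[lshift _ _]/(unsplit (inl i)) unsplitK.
  by rewrite -[rshift _ _]/(unsplit (inr i)) unsplitK.
- move=> r ts.
  have [n [v [us ->]]] := family_support (fun i => trename_support (ts i)).
  by exists n, v, (Rel r us).
- move=> p1 [n [v [u ->]]] p2 [n' [v' [u' ->]]].
  exists (n + n'), (fun i : 'I_(n + n') => copair v v' (fintype.split i)).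
  exists (Imp (rename (@lshift n n') u) (rename (@rshift n n') u')).
  rewrite /= !rename_comp; congr Imp; congr rename; apply/funext => i /=.
    by rewrite -[lshift _ _]/(unsplit (inl i)) unsplitK.
  by rewrite -[rshift _ _]/(unsplit (inr i)) unsplitK.
- move=> p [n [v [u ->]]].
  have [[x0]|noV] := pselect (inhabited V).
    exists n, (fun i => if v i is Some x then x else x0).
    exists (All (rename (fun i => if v i is Some _ then Some i else None) u)).
    rewrite /= !rename_comp; congr All; congr rename; apply/funext => i /=.
    by case E: (v i) => [x|] /=; rewrite ?E.
  exists 0, (fun i : 'I_0 => match notF (ltn_ord i) with end).
  exists (All (rename (fun=> None) u)).
  rewrite /= !rename_comp; congr All; congr rename; apply/funext => i /=.
  by case: (v i) => // x; case: noV.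
Qed.

Definition Ex (V : Type) (phi : formula L (option V)) : formula L V :=
  Not (All (Not phi)).

Lemma sat_Ex M (V : Type) (e : V -> M) (phi : formula L (option V)) :
  sat e (Ex phi) <-> exists x, sat (oapp e x) phi.
Proof.
split; last by move=> [x Hx] H; exact: (H x Hx).
by move=> H; apply: contrapT => N; apply: H => x Hx; apply: N; exists x.
Qed.

Definition And (V : Type) (phi psi : formula L V) : formula L V :=
  Not (Imp phi (Not psi)).

Lemma sat_And M (V : Type) (e : V -> M) (phi psi : formula L V) :
  sat e (And phi psi) <-> sat e phi /\ sat e psi.
Proof.
split; last by move=> [H1 H2] H; exact: (H H1 H2).
by move=> H; split; apply: contrapT => N; apply: H => // ? ?.
Qed.

Lemma conj_ex (V : Type) n (phi : 'I_n -> formula L V) :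
  exists psi, forall (N : structure L) (e : V -> N),
    sat e psi <-> forall i, sat e (phi i).
Proof.
elim: n phi => [|n IH] phi.
  by exists (Not Bot) => N e; split=> // _ [].
have [psi Hpsi] := IH (fun i => phi (lift ord0 i)).
exists (And (phi ord0) psi) => N e; rewrite sat_And Hpsi; split.
  by move=> [H0 H] i; case: (unliftP ord0 i) => [j|] ->.
by move=> H; split.
Qed.

(** One formula serves all structures, so that its truth can be compared in [M]
    and in [MM]. *)
Lemma exists_block n (V : Type) (phi : formula L ('I_n + V)) :
  exists psi : formula L V, forall (N : structure L) (e : V -> N),
    sat e psi <-> exists c : 'I_n -> N, sat (copair c e) phi.
Proof.
elim: n V phi => [|n IH] V phi.
  exists (rename (fun w : 'I_0 + V => match w with
    | inl i => match notF (ltn_ord i) with end | inr v => v end) phi) => N e.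
  rewrite sat_rename; split=> [H|[c H]].
    exists (fun i : 'I_0 => match notF (ltn_ord i) with end).
    by congr (sat _ _) : H; apply/funext => -[[]|].
  by congr (sat _ _) : H; apply/funext => -[[]|].
have [psi Hpsi] := IH (option V) (rename (fun w : 'I_n.+1 + V => match w with
  | inl i => if unlift ord0 i is Some j then inl j else inr None
  | inr v => inr (Some v) end) phi).
exists (Ex psi) => N e; rewrite sat_Ex; split.
  move=> [x /Hpsi[c]]; rewrite sat_rename => H.
  exists (fun i => if unlift ord0 i is Some j then c j else x).
  by congr (sat _ _) : H; apply/funext => -[i|v] //=; case: unlift.
move=> [c H]; exists (c ord0); apply/Hpsi; exists (fun j => c (lift ord0 j)).
rewrite sat_rename; congr (sat _ _) : H; apply/funext => -[i|v] //=.
by case: (unliftP ord0 i) => [j|] ->.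
Qed.

Lemma sat_automorphism M (s : M -> M) : automorphism s ->
  forall (V : Type) (e : V -> M) (phi : formula L V),
  sat (s \o e) phi <-> sat e phi.
Proof.
move=> [sbij sf sr].
have ev (V : Type) (e : V -> M) (t : term L V) :
    eval (s \o e) t = s (eval e t).
  elim: t => [//|f ts IH] /=; rewrite sf; congr (fint M f).
  by apply/funext => i; apply: IH.
move=> V e phi; elim: phi e => {V} V /=.
- by [].
- move=> t u e; rewrite !ev; split=> [|-> //]; exact: (bij_inj sbij).
- move=> r ts e; rewrite (sr r (fun i => eval e (ts i))).
  suff -> : (fun i => eval (s \o e) (ts i)) = s \o (fun i => eval e (ts i)).
    by [].
  by apply/funext => i; exact: ev.
- by move=> p1 IH1 p2 IH2 e; rewrite IH1 IH2.
- move=> p IH e; have [s' sK s'K] := sbij; split=> H x.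
    by rewrite -IH; move: (H (s x)); congr (sat _ _); apply/funext => -[].
  rewrite -[x]s'K; move: (H (s' x)); rewrite -IH.
  by congr (sat _ _); apply/funext => -[].
Qed.

End Syntax.

(** * Finite sets and words *)

Lemma filter_finite (T I : Type) (F : set_system T) (D : set I)
    (f : I -> set T) : Filter F -> finite_set D ->
  (forall i, D i -> F (f i)) -> F [set x | forall i, D i -> f i x].
Proof.
elim/Pchoice: I => I in D f *.
move=> FF /finite_fsetP[X ->] H.
by apply: filterS (@filter_bigI T I X f F FF _) => [x Hx i|i] Xi;
  [apply: Hx|apply: H].
Qed.

Lemma finite_set_enum (T : Type) (D : set T) : finite_set D ->
  exists k (g : 'I_k -> T), D = range g.
Proof.
elim/Pchoice: T => T in D *.
move=> /finite_seqP[s ->]; exists (size s), (tnth (in_tuple s)).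
apply/seteqP; split=> x.
  move=> /= xs; have ixs : index x s < size s by rewrite index_mem.
  by exists (Ordinal ixs) => //; rewrite (tnth_nth x) /= nth_index.
by move=> [i _ <-] /=; rewrite mem_tnth.
Qed.

(** Two incomparable words branch at their meet, the smaller one to the left. *)
Lemma wlex_wmeet (eta nu : seq bool) : incomparable eta nu -> wlex eta nu ->
  prefix (rcons (wmeet eta nu) false) eta /\
  prefix (rcons (wmeet eta nu) true) nu.
Proof.
rewrite /wlex => I; rewrite I /= => /orP[/andP[pr _]|].
  by move: I; rewrite /incomparable pr.
move: I; elim: eta nu => [|x eta IH] [|y nu] //.
rewrite /incomparable /=; have [->|nxy] := eqVneq x y.
  by move=> I lx /=; rewrite /= ?eqxx /= in I lx *; exact: IH.
by move=> _ /=; case: x y nxy => [] [] //= _ _; rewrite !prefix0s.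
Qed.

Lemma prefix_mkseq (eta : nat -> bool) (i j : nat) : i < j ->
  prefix (mkseq eta i) (mkseq eta j) /\ mkseq eta i != mkseq eta j.
Proof.
move=> ij; split; last first.
  by apply/negP => /eqP /(congr1 size); rewrite !size_mkseq => E;
    rewrite E ltnn in ij.
rewrite -(subnKC (ltnW ij)) /mkseq iotaD map_cat; exact: prefix_prefix.
Qed.

(** Members of a path are listed from the top down, which is the order in which
    the tree construction makes them a Morley sequence. *)
Lemma decreasing_enum (k : nat) (j : 'I_k -> nat) : injective j ->
  exists t : nat -> nat, (forall i i', i < i' -> i' < k -> t i' < t i) /\
    forall i, i < k -> exists x, t i = j x.
Proof.
move=> jinj; pose s := sort geq (codom j).
have ss : size s = k by rewrite size_sort size_codom card_ord.
exists (nth 0 s); split=> [i i' ii' i'k|i ik]; last first.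
  have : nth 0 s i \in s by rewrite mem_nth ?ss.
  by rewrite mem_sort => /codomP[x ->]; exists x.
have us : uniq s by rewrite sort_uniq; apply/injectiveP.
rewrite ltn_neqAle nth_uniq ?ss ?(ltn_trans ii') // gtn_eqF //=.
have st : sorted geq s by apply: sort_sorted => x y; exact: leq_total.
have tr : transitive geq by move=> y x z xy yz; exact: leq_trans yz xy.
apply: (sorted_leq_nth tr (leqnn : reflexive geq) 0 st) => //; last exact: ltnW.
  by rewrite inE ss (ltn_trans ii').
by rewrite inE ss.
Qed.

(** Some colour class exceeds its quota [k i]; its elements are listed in
    increasing order because a subsequence of a Morley sequence is one only if it
    keeps the order. *)
Lemma pigeonhole (d N : nat) (k : 'I_d -> nat) (col : 'I_N -> 'I_d) :
  \sum_i k i < N -> exists i, exists t : nat -> nat,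
    (forall x y, x < y -> y < k i -> t x < t y) /\
    forall x, x < k i -> exists2 z : 'I_N, t x = z & col z = i.
Proof.
move=> kN.
have [i ki] : exists i, k i < #|[pred z | col z == i]|.
  apply/existsP; apply: contraLR kN; rewrite negb_exists -leqNgt => /forallP H.
  rewrite -[X in X <= _]card_ord -sum1_card (partition_big col xpredT) //=.
  by apply: leq_sum => i _; rewrite sum1_card leqNgt.
pose s := map val (enum [pred z | col z == i]).
have ss : k i < size s by rewrite size_map -cardE.
exists i, (nth 0 s); split=> [x y xy yk|x xk].
  have so : sorted ltn s.
    rewrite /s /enum_mem; apply: (subseq_sorted ltn_trans _ (iota_ltn_sorted 0 N)).
    by rewrite -val_enum_ord; apply: map_subseq; rewrite -enumT; exact: filter_subseq.
  rewrite (sorted_ltn_nth ltn_trans 0 so) // inE (ltn_trans _ ss) //.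
  exact: ltn_trans yk.
have : nth 0 s x \in s by rewrite mem_nth // (ltn_trans xk).
by move=> /mapP[z]; rewrite mem_enum inE => /eqP cz ->; exists z.
Qed.

(** * Small sets *)

Section Small.
Variable K : Type.
Hypothesis KP : uncountable_strong_limit K.

Lemma finite_small (T : Type) (A : set T) : finite_set A -> small K A.
Proof.
move=> fA; have [[natK _] _] := KP; split.
  by apply: card_le_trans natK; apply: finite_set_countable.
by move=> KA; have := card_le_finite (card_le_trans natK KA) fA;
  exact: infinite_nat.
Qed.

(** Hilbert's hotel: the new point takes the place of the first term of an
    injective sequence, which is shifted by one. *)
Lemma infinite_add1 (T : Type) (A : set T) (x : T) :
  infinite_set A -> A `|` [set x] #<= A.
Proof.
have [Ax _|nAx] := pselect (A x).
  by apply: subset_card_le => y [//|->].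
elim/Ppointed: T => T in A x nAx *; first by case: (T x).
move=> /infiniteP/pcard_leP[g].
have ginj i j : g i = g j -> i = j.
  by move=> E; apply: (@inj _ _ _ g); rewrite ?inE.
have gA i : A (g i) := @funS _ _ _ _ g i Logic.I.
have /choice[h hP] y : exists z,
    (y = x /\ z = g 0) \/ (exists2 i, y = g i & z = g i.+1) \/
    [/\ y <> x, forall i, y <> g i & z = y].
  have [->|yx] := pselect (y = x).
    by exists (g 0); left.
  have [[i ->]|N] := pselect (exists i, y = g i).
    by exists (g i.+1); right; left; exists i.
  by exists y; right; right; split=> // i E; apply: N; exists i.
apply/pcard_leP/injfunPex; exists h.
  move=> y Ay; case: (hP y) => [[_ ->]|[[i _ ->]|[yx _ ->]]] //.
  by case: Ay.
move=> y z; rewrite !inE => Ay Az E.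
case: (hP y) (hP z) => [[yE Hy]|[[i yE Hy]|[yx yg Hy]]]
  [[zE Hz]|[[j zE Hz]|[zx zg Hz]]]; rewrite {}Hy {}Hz in E.
- by rewrite yE zE.
- by have := ginj _ _ E.
- by case: (zg 0).
- by have := ginj _ _ E.
- by have := ginj _ _ E => -[ij]; rewrite yE zE ij.
- by case: (zg i.+1).
- by case: (yg 0).
- by case: (yg j.+1).
- by [].
Qed.

Lemma small_add1 (T : Type) (A : set T) (x : T) :
  small K A -> small K (A `|` [set x]).
Proof.
move=> [AK KA]; have [fA|iA] := pselect (finite_set A).
  by apply: finite_small; rewrite finite_setU; split=> //; exact: finite_set1.
have Ax := infinite_add1 x iA; split; first exact: card_le_trans Ax AK.
by move=> H; apply: KA; exact: card_le_trans H Ax.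
Qed.

Lemma small_range (T : Type) (A : set T) (V : finType) (b : V -> T) :
  small K A -> small K (A `|` range b).
Proof.
move=> sA; have -> : range b = [set b v | v in [set v | v \in enum V]].
  by apply/seteqP; split=> [_ [v _ <-]|_ [v _ <-]]; exists v => //=;
    rewrite mem_enum.
elim: (enum V) => [|v s IH].
  suff -> : [set b v | v in [set v | v \in [::]]] = set0.
    by rewrite setU0.
  by apply/seteqP; split=> [y [v]|y []].
suff -> : A `|` [set b w | w in [set w | w \in v :: s]] =
    (A `|` [set b w | w in [set w | w \in s]]) `|` [set b v].
  exact: small_add1.
apply/seteqP; split=> y.
  move=> [Ay|[w /=]]; first by left; left.
  rewrite inE => /orP[/eqP-> <-|ws <-]; first by right.
  by left; right; exists w.
move=> [[Ay|[w ws <-]]|->]; first by left.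
  by right; exists w => //=; rewrite inE ws orbT.
by right; exists v => //=; rewrite inE eqxx.
Qed.

End Small.

(** * Types over small sets in the monster model *)

Section Monster.
Variables (L : language) (MM : structure L) (K : Type).
Hypothesis KP : uncountable_strong_limit K.
Hypothesis satu : saturated K MM.
Hypothesis homo : strongly_homogeneous K MM.
Variable M : set MM.
Hypothesis sM : small K M.
Hypothesis elM : elementary_submodel M.

(** Same type over [M], for tuples indexed by any type. *)
Definition eqtp (V : Type) (u v : V -> MM) : Prop :=
  forall phi : formula L (V + M),
    sat (copair u val) phi <-> sat (copair v val) phi.

Definition fixes (s : MM -> MM) : Prop :=
  automorphism s /\ forall x, M x -> s x = x.

Lemma copair_fixes (s : MM -> MM) (V : Type) (u : V -> MM) :
  fixes s -> copair (s \o u) (val : M -> MM) = s \o copair u val.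
Proof.
move=> [_ fs]; apply/funext => -[//|m] /=.
by rewrite fs //; apply: set_valP.
Qed.

Lemma eqtp_fixes (s : MM -> MM) (V : Type) (u : V -> MM) :
  fixes s -> eqtp (s \o u) u.
Proof.
by move=> fs phi; rewrite copair_fixes //; apply: sat_automorphism; case: fs.
Qed.

Lemma eqtp_sym (V : Type) (u v : V -> MM) :
  eqtp u v -> eqtp v u.
Proof. by move=> H phi; split=> /H. Qed.

Lemma eqtp_trans (V : Type) (u v w : V -> MM) :
  eqtp u v -> eqtp v w -> eqtp u w.
Proof. by move=> H H' phi; rewrite H. Qed.

Lemma eqtp_comp (V W : Type) (u v : V -> MM) (g : W -> V) :
  eqtp u v -> eqtp (u \o g) (v \o g).
Proof.
move=> H phi; have := H (rename (copair (inl \o g) inr) phi).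
by rewrite !sat_rename !comp_copair.
Qed.

Lemma eqtp_tp n (u v : 'I_n -> MM) :
  eqtp u v <-> tp u (A := M) = tp v (A := M).
Proof.
split=> [H|H phi].
  by apply/funext => phi; apply/propext; exact: H.
have : tp u (A := M) phi = tp v (A := M) phi by rewrite H.
by rewrite /tp /= => ->.
Qed.

(** Homogeneity, in the form that replaces most constructions of formulas below:
    a property of finite tuples that is invariant under the automorphisms over
    [M] depends only on their type over [M]. *)
Lemma conjugate (V : finType) (u v : V -> MM) :
  eqtp u v -> exists2 s, fixes s & s \o u = v.
Proof.
move=> uv.
have feq (x y : V + M) :
    copair u val x = copair u val y -> copair v val x = copair v val y.
  by have /= [] := uv (Eq (Var x) (Var y)).
have fex : forall x : MM, exists y : MM, forall w : V + M,
    copair u val w = x -> y = copair v val w.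
  move=> x; have [[w Hw]|N] := pselect (exists w : V + M, copair u val w = x).
    by exists (copair v val w) => w' Hw'; apply: feq; rewrite Hw.
  by exists x => w Hw; case: N; exists w.
have [f fP] := choice fex.
have Dw x : (M `|` range u) x ->
    exists w, copair u (val : M -> MM) w = x.
  move=> [Mx|[i _ <-]]; last by exists (inl i).
  by exists (inr (SigSub (mem_set Mx))).
have [n phi e De|s [sa sf]] := homo (f := f) (small_range KP u sM).
  have [w Hw] := choice (fun i => Dw _ (De i)).
  have -> : e = copair u val \o w by apply/funext => i; rewrite /= Hw.
  have -> : f \o (copair u val \o w) = copair v val \o w.
    by apply/funext => i; apply: fP.
  by rewrite -!sat_rename.
exists s; last first.
  by apply/funext => i /=; rewrite sf; [apply: (fP _ (inl i))|right; exists i].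
split=> // x Mx; rewrite sf; last by left.
by rewrite (fP _ (inr (SigSub (mem_set Mx)))).
Qed.

(** * Global invariant types in arbitrary variables *)

(** [inst], for variables indexed by any type. *)
Definition plug (V W : Type) (phi : formula L (V + W)) (b : W -> MM) :
    formula L (V + MM) :=
  rename (copair inl (inr \o b)) phi.

Lemma sat_plug (V W : Type) (phi : formula L (V + W)) (b : W -> MM)
    (c : V -> MM) :
  sat (copair c id) (plug phi b) = sat (copair c b) phi.
Proof.
by rewrite /plug sat_rename; congr sat; apply/funext => -[].
Qed.

Definition consis (V : Type) (p : set (formula L (V + MM))) : Prop :=
  forall F, finite_set F -> F `<=` p ->
    exists c : V -> MM, forall phi, F phi -> sat (copair c id) phi.

(** Global [M]-invariant types.  Variables and parameters are indexed by arbitrary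
    types, so that trees and sums of tuples need no coding by ordinals. *)
Record invariant_type (V : Type) (p : set (formula L (V + MM))) : Prop :=
  InvariantType {
    it_consis : consis p;
    it_total : forall phi, p phi \/ p (Not phi);
    it_invariant : forall (W : Type) (phi : formula L (V + (W + M)))
      (b b' : W -> MM), eqtp b b' ->
      p (plug phi (copair b val)) -> p (plug phi (copair b' val)) }.

Lemma it_Not (V : Type) (p : set (formula L (V + MM))) phi :
  invariant_type p -> p (Not phi) -> ~ p phi.
Proof.
move=> [pc _ _] pN pP.
have [||c Hc] := pc [set phi; Not phi].
- by rewrite finite_setU; split; apply: finite_set1.
- by move=> _ [->|->].
have : sat (copair c id) (Not phi) by apply: Hc; right.
by apply; apply: Hc; left.
Qed.

(** [c] realizes the restriction of [p] to [M] and the members of [B]. *)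
Definition realizes_over (V W : Type) (p : set (formula L (V + MM)))
    (c : V -> MM) (B : W -> MM) : Prop :=
  forall phi : formula L (V + (W + M)),
    p (plug phi (copair B val)) -> sat (copair c (copair B val)) phi.

Lemma realizes_overE (V W : Type) (p : set (formula L (V + MM)))
    (c : V -> MM) (B : W -> MM) : invariant_type p -> realizes_over p c B ->
  forall phi : formula L (V + (W + M)),
    p (plug phi (copair B val)) <-> sat (copair c (copair B val)) phi.
Proof.
move=> pI cB phi; split; first exact: cB.
have [//|/[dup] pN _] := it_total pI (plug phi (copair B val)).
by have := cB (Not phi) pN => /[apply].
Qed.

Definition assoc (U V W : Type) (x : (U + V) + W) : U + (V + W) :=
  match x with
  | inl (inl u) => inl u | inl (inr v) => inr (inl v) | inr w => inr (inr w)
  end.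

Lemma copair_assoc (U V W X : Type) (f : U -> X) (g : V -> X) (h : W -> X) :
  copair f (copair g h) \o @assoc U V W = copair (copair f g) h.
Proof. by apply/funext => -[[]|]. Qed.

(** The type over [M] of a realization is determined by the parameters. *)
Lemma realizes_eqtp (V W : Type) (p : set (formula L (V + MM)))
    (c c' : V -> MM) (B B' : W -> MM) :
  invariant_type p -> realizes_over p c B -> realizes_over p c' B' ->
  eqtp B B' -> eqtp (copair c B) (copair c' B').
Proof.
move=> pI cB cB' BB' phi; rewrite -!copair_assoc -!sat_rename.
rewrite -(realizes_overE pI cB) -(realizes_overE pI cB').
by split; apply: (it_invariant pI) => //; apply: eqtp_sym.
Qed.

Lemma realizes_transfer (V W : Type) (p : set (formula L (V + MM)))
    (c c' : V -> MM) (B B' : W -> MM) :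
  invariant_type p -> eqtp (copair c B) (copair c' B') ->
  realizes_over p c B -> realizes_over p c' B'.
Proof.
move=> pI E cB phi p'.
have BB' : eqtp B' B by apply: eqtp_sym; exact: (eqtp_comp inr E).
have := cB _ (it_invariant pI BB' p').
have := E (rename (fun x : V + (W + M) => match x with
  | inl v => inl (inl v) | inr (inl w) => inl (inr w)
  | inr (inr m) => inr m end) phi).
rewrite !sat_rename => H.
have e (a : V -> MM) (b : W -> MM) :
    copair (copair a b) (val : M -> MM) \o (fun x : V + (W + M) => match x with
    | inl v => inl (inl v) | inr (inl w) => inl (inr w)
    | inr (inr m) => inr m end) = copair a (copair b val).
  by apply/funext => -[|[]].
by rewrite !e in H; move/H.
Qed.

Lemma realizes_sub (V W W' : Type) (p : set (formula L (V + MM)))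
    (c : V -> MM) (B : W -> MM) (g : W' -> W) :
  realizes_over p c B -> realizes_over p c (B \o g).
Proof.
move=> cB phi pphi; pose k := copair (inl \o g) (@inr W M).
have -> : copair c (copair (B \o g) val) =
    copair c (copair B val) \o copair inl (inr \o k).
  by apply/funext => -[|[]].
rewrite -sat_rename; apply: cB; congr (p _) : pphi.
by rewrite /plug !rename_comp; congr rename; apply/funext => -[|[]].
Qed.

Lemma realizes_eqtp0 (V W W' : Type) (p : set (formula L (V + MM)))
    (c c' : V -> MM) (B : W -> MM) (B' : W' -> MM) :
  invariant_type p -> realizes_over p c B -> realizes_over p c' B' ->
  eqtp c c'.
Proof.
move=> pI cB cB'; pose z := @of_void.
have := @realizes_eqtp V void p c c' (B \o z W) (B' \o z W') pI.
have E : B \o z W = B' \o z W' by apply/funext => -[].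
rewrite -E => /(_ (realizes_sub cB)) H.
have : realizes_over p c' (B \o z W) by rewrite E; exact: realizes_sub.
by move=> /H /(_ (fun=> iff_refl _)) /(eqtp_comp inl).
Qed.

(** Saturation over [M] and finitely many further parameters. *)
Lemma realize (V W : finType) (p : set (formula L (V + MM))) (B : W -> MM) :
  consis p -> exists c, realizes_over p c B.
Proof.
move=> pc; pose D := M `|` range B.
pose tau := rename (L := L) (copair (inl \o @enum_val V predT) (@inr V MM)).
pose q : set (formula L ('I_#|V| + D)) := [set phi | p (tau (inst phi val))].
have [|c Hc] := satu (small_range KP B sM) (q := q).
  move=> F fF Fq; have [||c Hc] := pc (tau @` F).
  - exact: finite_image.
  - by move=> _ [phi /Fq[psi qpsi <-] <-].
  exists (c \o enum_val) => phi Fphi.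
  have := Hc (tau phi) (ex_intro2 _ _ phi Fphi erefl).
  by rewrite /tau sat_rename comp_copair.
have Dw (x : W + M) : D (copair B val x).
  by case: x => [w|m]; [right; exists w|left; apply: set_valP].
pose d (x : W + M) : D := SigSub (mem_set (Dw x)).
exists (c \o enum_rank) => phi pphi.
have := Hc (rename (copair (inl \o enum_rank) (inr \o d)) phi).
rewrite sat_rename comp_copair; apply.
rewrite /q /= /tau; congr (p _) : pphi.
rewrite /inst /plug !rename_comp; congr rename.
by apply/funext => -[v|w] //=; rewrite enum_rankK.
Qed.

Lemma submodel_point : exists m : MM, M m.
Proof. by case: elM => -[m] _; exists (val m); apply: set_valP. Qed.

Lemma eqtp_params (V W : Type) (b b' : V -> MM) (u : W -> V + M) :
  eqtp b b' -> eqtp (copair b val \o u) (copair b' val \o u).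
Proof.
move=> bb' phi; have := bb' (rename (copair u inr) phi).
by rewrite !sat_rename !comp_copair.
Qed.

(** A formula with arbitrarily many parameters uses finitely many of them. *)
Lemma invariant_type_of n (p : set (formula L ('I_n + MM))) :
  global_type p -> Defs.invariant M p -> invariant_type p.
Proof.
move=> [pc pt] pI; split=> // W phi b b' bb'.
have [m0 Mm0] := submodel_point; pose x0 : M := SigSub (mem_set Mm0).
have [k [u [psi ->]]] := rename_support phi.
pose u1 (j : 'I_k) : 'I_n + ('I_k + M) := match u j with
  | inl i => inl i | inr (inl w) => inr (inl j) | inr (inr m) => inr (inr m) end.
pose u2 (j : 'I_k) : W + M := match u j with inr (inl w) => inl w
  | _ => inr x0 end.
have E c : plug (rename u psi) (copair c val) =
    inst (rename u1 psi) (copair (copair c val \o u2) val).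
  rewrite /inst /plug !rename_comp; congr rename; apply/funext => j.
  rewrite /= /u1; case uj: (u j) => [i|[w|m]] //=.
  by rewrite /u2 uj.
by rewrite !E; apply: (pI _ _ _ _ _).1; apply/eqtp_tp; exact: eqtp_params.
Qed.

(** * Finite satisfiability in the submodel *)

Lemma elementaryT (V : Type) (A0 : inhabited M) (Af : fclosed_set M) :
  elementary (val : substructure A0 Af -> MM) ->
  forall (phi : formula L V) (e : V -> substructure A0 Af),
  sat e phi <-> sat (val \o e) phi.
Proof.
move=> el phi e; have [n [v [psi ->]]] := rename_support phi.
by rewrite !sat_rename; exact: el.
Qed.

(** A formula over [M] with a solution in [MM] has one in [M], also when its
    variables form an infinite family. *)
Lemma Tarski_Vaught (V : Type) (phi : formula L (V + M)) (e : V -> MM) :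
  sat (copair e val) phi ->
  exists2 w : V -> MM, (forall v, M (w v)) & sat (copair w val) phi.
Proof.
have [A0 [Af el]] := elM.
have [k [u [psi ->]]] := rename_support phi.
(* a variable of phi may be listed several times by u; rho picks one of its
   places, so that all of them receive the same value *)
pose I v (o : option 'I_k) := if o is Some i then u i = inl v
  else forall i, u i <> inl v.
have /choice[rho rhoP] : forall v, exists o, I v o.
  move=> v; have [[i Hi]|N] := pselect (exists i, u i = inl v).
    by exists (Some i).
  by exists None => i Hi; apply: N; exists i.
pose t i : 'I_k + substructure A0 Af := match u i with
  | inl v => if rho v is Some j then inl j else inl i | inr m => inr m end.
have [chi Hchi] := exists_block (rename t psi).
rewrite sat_rename => Hpsi.
have : sat (val : substructure A0 Af -> MM) chi.
  apply/Hchi; exists (copair e val \o u); rewrite sat_rename.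
  congr (sat _ _) : Hpsi; apply/funext => i; rewrite /= /t.
  case ui: (u i) => [v|m] //=; have := rhoP v.
  by case: (rho v) => [j|] /=; rewrite ?ui //= => ->.
rewrite -[val]/(val \o id) -elementaryT // => /Hchi[c].
rewrite (elementaryT el) sat_rename => Hc.
have [m0 Mm0] := submodel_point.
exists (fun v => if rho v is Some j then val (c j) else m0).
  by move=> v; case: (rho v) => [j|] //; apply: set_valP.
rewrite sat_rename; congr (sat _ _) : Hc; apply/funext => i; rewrite /= /t.
case ui: (u i) => [v|m] //=; have := rhoP v.
by case: (rho v) => [j|] //= /(_ i).
Qed.

(** * A minimal flow of coheirs *)

(** The maps onto [M], identical on [M], that keep [phi] true of the elements that
    it mentions. *)
Definition retraction (phi : formula L MM) : set (MM -> MM) :=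
  [set f | [/\ forall a, M (f a), forall a, M a -> f a = a & sat f phi]].

(** The ultrafilters that refine this filter correspond to the coheirs over [M] of
    the type of the whole of [MM]. *)
Definition retractions : set_system (MM -> MM) :=
  filter_from [set phi | sat (id : MM -> MM) phi] retraction.

(** A formula true in [MM] can be satisfied in [M] without moving its parameters
    from [M]. *)
Lemma retractions_proper : ProperFilter retractions.
Proof.
apply: filter_from_proper.
  apply: filter_from_filter; first by exists (Not Bot); exact: id.
  move=> phi psi sphi spsi; exists (And phi psi).
    exact/sat_And.
  by move=> f [fM fid /sat_And[]].
move=> phi sphi.
pose t (a : MM) : MM + M :=
  if pselect (M a) is left Ma then inr (SigSub (mem_set Ma)) else inl a.
have [|w wM] := Tarski_Vaught (phi := rename t phi) (e := id).
  rewrite sat_rename; congr (sat _ _) : sphi.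
  by apply/funext => a /=; rewrite /t; case: pselect.
rewrite sat_rename => Hw; exists (copair w val \o t); split=> // a.
  by rewrite /= /t; case: pselect => [Ma|nMa] /=.
by move=> Ma; rewrite /= /t; case: pselect => [Ma1|nMa] /=.
Qed.

Definition flow_invariant (F : set_system (MM -> MM)) : Prop :=
  forall s, fixes s -> forall D, F D -> F [set f : MM -> MM | D (f \o s)].

Lemma retractions_invariant : flow_invariant retractions.
Proof.
move=> s [sa sf] D [phi sphi phiD]; exists (rename s phi).
  by rewrite /= sat_rename; apply/(sat_automorphism sa).
move=> f [fM fid]; rewrite sat_rename => sfphi; apply: phiD; split=> //= a.
by move=> Ma; rewrite sf ?fid.
Qed.

(** A filter stands for the closed set of the ultrafilters that refine it, so a
    maximal invariant filter stands for a minimal closed invariant set. *)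
Record minimal_flow (F : set_system (MM -> MM)) : Prop := MinimalFlow {
  mf_proper : ProperFilter F;
  mf_invariant : flow_invariant F;
  mf_sub : retractions `<=` F;
  mf_max : forall G, ProperFilter G -> flow_invariant G -> F `<=` G -> G `<=` F }.

(** Zorn's lemma, applied to the filters obtained by adding a family of sets to
    [retractions]. *)
Lemma minimal_flow_exists : exists F, minimal_flow F.
Proof.
pose B0 := retractions.
pose good (F : set_system (MM -> MM)) := ProperFilter F /\ flow_invariant F.
pose P X := good (X `|` B0).
have P0 : P set0.
  by rewrite /P set0U; split; [apply: retractions_proper|
    apply: retractions_invariant].
have [F FP totF|A [[PA IA] maxA]] := @Zorn_bigcup _ P.
  pose F' := F `|` [set set0].
  have FP' X : F' X -> P X by case=> [/FP|->].
  have totF' X Y : F' X -> F' Y -> X `<=` Y \/ Y `<=` X.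
    move=> [FX|->]; last by left.
    move=> [FY|->]; last by right.
    exact: totF.
  have inF A : ((\bigcup_(X in F) X) `|` B0) A <-> exists2 X, F' X & (X `|` B0) A.
    split=> [[[X FX XA]|BA]|[X [FX|->] [XA|BA]]] //.
    - by exists X; [left|left].
    - by exists set0; [right|right].
    - by left; exists X.
    - by right.
    - by right.
  have inF2 A C : ((\bigcup_(X in F) X) `|` B0) A ->
      ((\bigcup_(X in F) X) `|` B0) C ->
      exists X, [/\ F' X, (X `|` B0) A & (X `|` B0) C].
    move=> /inF[X FX XA] /inF[Y FY YC].
    case: (totF' X Y FX FY) => XY; [exists Y|exists X]; split=> //.
      by case: XA => [/XY|]; [left|right].
    by case: YC => [/XY|]; [left|right].
  split; first split; last first.
  - move=> s fs D /inF[X FX XD]; apply/inF; exists X => //.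
    by have [_ IX] := FP' X FX; exact: IX.
  - split.
    + by have [p _] := P0; right; rewrite -[B0]set0U; apply: filterT.
    + move=> A C HA HC; have [X [FX XA XC]] := inF2 _ _ HA HC.
      have [PX _] := FP' X FX; apply/inF; exists X => //; exact: filterI.
    + move=> A C AC /inF[X FX XA]; apply/inF; exists X => //.
      have [PX _] := FP' X FX; exact: filterS XA.
  - move=> /inF[X FX X0]; have [PX _] := FP' X FX; exact: filter_not_empty X0.
exists (A `|` B0); split=> //.
move=> G PG IG AG; apply: contrapT => nG.
apply: (maxA G).
  split=> [D AD|GA]; first by apply: AG; left.
  by apply: nG => D /GA AD; left.
rewrite /P (_ : G `|` B0 = G) //.
by apply/seteqP; split=> D; [move=> [//|BD]; apply: AG; right|left].
Qed.

Variables (F : set_system (MM -> MM)).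
Hypothesis FF : minimal_flow F.

(** In a minimal flow, finitely many translates of a nonempty open set cover
    the flow: otherwise the points that all translates avoid would form a smaller
    flow. *)
Lemma finite_cover (U : set_system (MM -> MM)) (B : set (MM -> MM)) :
  ProperFilter U -> F `<=` U -> U B ->
  exists k (s : 'I_k -> MM -> MM), (forall i, fixes (s i)) /\
    F [set f : MM -> MM | exists i, B (f \o s i)].
Proof.
move=> PU FU UB; apply: contrapT => N.
pose avoid k (s : 'I_k -> MM -> MM) := [set f : MM -> MM | forall i, ~ B (f \o s i)].
pose G := [set D | exists k (s : 'I_k -> MM -> MM),
  (forall i, fixes (s i)) /\ exists2 D0, F D0 & D0 `&` avoid k s `<=` D].
have PF := mf_proper FF.
have FG : F `<=` G.
  move=> D FD; exists 0, (fun=> id); split; first by case.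
  by exists D => // f [].
have IG : flow_invariant G.
  move=> t ft D [k [s [fs [D0 FD0 D0D]]]].
  exists k, (fun i => t \o s i); split.
    move=> i; have [[sb sf sr] sM'] := fs i.
    have [[tb tf tr] tM'] := ft; split; last by move=> x Mx /=; rewrite sM' // tM'.
    split; first exact: bij_comp.
      by move=> f v /=; rewrite sf tf.
    by move=> r v; rewrite sr tr.
  exists [set f : MM -> MM | D0 (f \o t)]; first exact: (mf_invariant FF).
  by move=> f [/= D0f Hf]; apply: D0D; split=> // i; exact: Hf.
have PG : ProperFilter G.
  split; last first.
    split.
    - by apply: FG; exact: filterT.
    - move=> C D [k [s [fs [C0 FC0 HC]]]] [l [t [ft [D0 FD0 HD]]]].
      exists (k + l), (fun i => copair s t (fintype.split i)); split.
        by move=> i; case: fintype.split => j /=.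
      exists (C0 `&` D0); first exact: filterI.
      move=> f [[C0f D0f] Hf]; split; [apply: HC|apply: HD]; split=> // i.
        by have := Hf (unsplit (inl i)); rewrite unsplitK.
      by have := Hf (unsplit (inr i)); rewrite unsplitK.
    - move=> C D CD [k [s [fs [C0 FC0 HC]]]]; exists k, s; split=> //.
      by exists C0 => // f /HC/CD.
  move=> [k [s [fs [D0 FD0 HD]]]]; apply: N; exists k, s; split=> //.
  apply: filterS FD0 => f D0f; apply: contrapT => Nf.
  by apply: (HD f); split=> // i Bf; apply: Nf; exists i.
have : F (~` B).
  apply: (mf_max FF PG IG FG); exists 1, (fun=> id); split.
    by move=> _; split=> //; split=> //; exists id.
  by exists setT; [exact: filterT|move=> f [_ /(_ ord0)]].
move=> /FU UnB; apply: (@filter_not_empty _ U _).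
by rewrite -(setICr B); exact: filterI.
Qed.

(** The image of [U] under evaluation at [A], which determines the coheir that [U]
    gives to [A]. *)
Definition push (U : set_system (MM -> MM)) (V : Type) (A : V -> MM) :
    set_system (V -> MM) :=
  [set D | U [set f : MM -> MM | D (f \o A)]].

(** Let [c] be in such a position over [A] that, over any finitely many
    conjugates of [A], a further conjugate can be found whose [g]-part is in
    this position over each of them.  Then [c] can be given the same coheir as
    the [g]-part of [A], without changing that of [A].  Otherwise there would be
    [D] such that, in the flow, [A] is in [D] only when [c] is not in the
    corresponding set [D2].  Cover the flow by finitely many translates of the
    event that [A] is in [D], and choose a conjugate [A'] whose [g]-part is in
    position over the corresponding conjugates of [A].  At each point of the flow
    one of these is in [D], hence the [g]-part of [A'] is not in [D2], and [A'] is
    not in [D]; by invariance neither is [A]. *)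
Lemma amalgamation (U : set_system (MM -> MM)) (V W : finType)
    (A : V -> MM) (g : W -> V) (c : W -> MM) :
  UltraFilter U -> F `<=` U ->
  (forall l (B : 'I_l -> V -> MM), (forall i, eqtp (B i) A) ->
    exists2 A' : V -> MM, eqtp A' A &
      forall i, eqtp (copair (B i) (A' \o g)) (copair A c)) ->
  exists U', [/\ UltraFilter U', F `<=` U',
    push U' A = push U A & push U' c = push U (A \o g)].
Proof.
move=> UU FU free; have PF := mf_proper FF.
pose G := filter_from
  [set X : set (MM -> MM) * (set (V -> MM) * set (W -> MM)) |
    [/\ F X.1, push U A X.2.1 & push U (A \o g) X.2.2]]
  (fun X => [set f | [/\ X.1 f, X.2.1 (f \o A) & X.2.2 (f \o c)]]).
have PG : ProperFilter G.
  apply: filter_from_proper.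
    apply: filter_from_filter.
      by exists (setT, (setT, setT)); split=> /=; exact: filterT.
    move=> [X [X1 X2]] [Y [Y1 Y2]] [/= FX UX1 UX2] [/= FY UY1 UY2].
    exists (X `&` Y, (X1 `&` Y1, X2 `&` Y2)).
      by split=> /=; [exact: filterI|exact: filterI UX1 UY1|
        exact: filterI UX2 UY2].
    by move=> f [/= [? ?] [? ?] [? ?]].
  move=> [D0 [D1 D2]] [/= FD0 UD1 UD2]; apply: contrapT => /forallNP N.
  pose D := [set v : V -> MM | D1 v /\ D2 (v \o g)].
  have UD : U [set f : MM -> MM | D (f \o A)].
    exact: (@filterI _ U _ [set f : MM -> MM | D1 (f \o A)] _ UD1 UD2).
  have [k [s [fs cover]]] := finite_cover _ FU UD.
  have [|A' A'A free'] := free k (fun i => s i \o A).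
    by move=> i; exact: eqtp_fixes.
  have [s' fs' s'A] := conjugate (eqtp_sym A'A).
  (* by invariance, A and c may be replaced by s i A and the g-part of A' *)
  have apart i : F [set f : MM -> MM |
      ~ (D (f \o (s i \o A)) /\ D2 (f \o (A' \o g)))].
    have [t ft tE] := conjugate (eqtp_sym (free' i)).
    have : F [set f : MM -> MM | ~ (D (f \o A) /\ D2 (f \o c))].
      by apply: filterS FD0 => f D0f [[D1f _] D2f]; apply: (N f); split.
    move=> /(mf_invariant FF ft); congr (F _); apply/seteqP.
    have tA : t \o A = s i \o A by move/(congr1 (fun h => h \o inl)): tE.
    have tc : t \o c = A' \o g by move/(congr1 (fun h => h \o inr)): tE.
    by split=> f; rewrite /= -tA -tc.
  have FA' : F [set f : MM -> MM | ~ D (f \o A')].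
    apply: filterS (filterI cover (filter_forall _ apart)).
    by move=> f [[i Di] /(_ i) Ni] DA'; apply: Ni; split=> //; case: DA'.
  have [s2 fs2 s2A] := conjugate A'A.
  have := mf_invariant FF fs2 FA' => /FU UN.
  apply: (@filter_not_empty _ U _); rewrite -(setICr [set f : MM -> MM | D (f \o A)]).
  apply: filterI => //; congr (U _) : UN; apply/seteqP.
  by split=> f; rewrite /= -s2A.
have [U' [UU' GU']] := ultraFilterLemma PG.
have inG X X1 X2 : F X -> push U A X1 -> push U (A \o g) X2 ->
    U' [set f | [/\ X f, X1 (f \o A) & X2 (f \o c)]].
  by move=> FX UX1 UX2; apply: GU'; exists (X, (X1, X2)).
have eqU (X : Type) (P Q : set_system X) : (forall D, P D \/ P (~` D)) ->
    (forall D, ~ (Q D /\ Q (~` D))) -> P `<=` Q -> Q = P.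
  move=> Pt QN PQ; apply/seteqP; split=> // D QD.
  by have [//|/PQ nD] := Pt D; case: (QN D).
have Ut X (h : (MM -> MM) -> X) (D : set X) :
    U [set f | D (h f)] \/ U (~` [set f | D (h f)]).
  exact: in_ultra_setVsetC.
have U'N X (h : (MM -> MM) -> X) (D : set X) :
    ~ (U' [set f | D (h f)] /\ U' (~` [set f | D (h f)])).
  by move=> [/filterI h1 /h1]; rewrite setICr; exact: (@filter_not_empty _ U' _).
have UT : U setT by exact: filterT.
have FT : F setT by exact: filterT.
exists U'; split=> //.
- move=> X FX; have H := inG X setT setT FX UT UT.
  by apply: (@filterS _ U' _ _ _ _ H) => f [].
- apply: eqU => [D|D|D UD]; [exact: Ut|exact: U'N|].
  have H := inG setT D setT FT UD UT.
  by apply: (@filterS _ U' _ _ [set f : MM -> MM | D (f \o A)] _ H) => f [].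
- apply: eqU => [D|D|D UD]; [exact: Ut|exact: U'N|].
  have H := inG setT setT D FT UT UD.
  by apply: (@filterS _ U' _ _ [set f : MM -> MM | D (f \o c)] _ H) => f [].
Qed.

(** [p] contains the type of [b] over [M]. *)
Definition extends (V : Type) (p : set (formula L (V + MM))) (b : V -> MM) :
    Prop :=
  forall phi : formula L (V + M), sat (copair b val) phi -> p (plug phi val).

Lemma extends_eqtp (V W : Type) (p : set (formula L (V + MM)))
    (b c : V -> MM) (B : W -> MM) :
  extends p b -> realizes_over p c B -> eqtp c b.
Proof.
move=> pb cB.
have H (phi : formula L (V + M)) :
    sat (copair b val) phi -> sat (copair c val) phi.
  move=> /pb pphi; have := cB (rename (copair inl (inr \o inr)) phi).
  rewrite sat_rename comp_copair; apply; congr (p _) : pphi.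
  by rewrite /plug !rename_comp; congr rename; apply/funext => -[].
move=> phi; split; last exact: H.
by move=> cphi; apply: contrapT => /(H (Not phi)); apply.
Qed.

Lemma realizes_empty (V W : Type) (p : set (formula L (V + MM)))
    (b c : V -> MM) (B : W -> MM) :
  (W -> False) -> invariant_type p -> extends p b -> eqtp c b ->
  realizes_over p c B.
Proof.
move=> W0 pI pb cb phi pphi; apply: contrapT => nphi.
pose k (x : V + (W + M)) : V + M := match x with
  | inl v => inl v | inr (inl w) => match W0 w with end
  | inr (inr m) => inr m end.
suff : p (Not (plug phi (copair B val))) by move=> /(it_Not pI).
have /pb : sat (copair b val) (Not (rename k phi)).
  apply/cb => /=; rewrite sat_rename => cphi; apply: nphi.
  by congr (sat _ _) : cphi; apply/funext => -[|[]].
congr (p _); rewrite /plug /= rename_comp; congr (Imp (rename _ _) _).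
by apply/funext => -[|[]].
Qed.

(** * The coheirs chosen by an ultrafilter of the flow *)

(** This is [M]-invariant because the values of the maps are in [M]. *)
Definition coheir (U : set_system (MM -> MM)) (V : Type) (A : V -> MM) :
    set (formula L (V + MM)) :=
  [set phi | push U A [set v | sat (copair v id) phi]].

Lemma coheir_comp U (V W : Type) (A : V -> MM) (g : W -> V) phi :
  coheir U (A \o g) phi = coheir U A (rename (copair (inl \o g) inr) phi).
Proof.
rewrite /coheir /push /=; congr U; apply/seteqP.
by split=> f /=; rewrite sat_rename comp_copair.
Qed.

Lemma coheir_realizes_comp U (V W X : Type) (A c : V -> MM) (g : W -> V)
    (B : X -> MM) :
  realizes_over (coheir U A) c B ->
  realizes_over (coheir U (A \o g)) (c \o g) B.
Proof.
move=> cB phi; rewrite coheir_comp => H.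
have := cB (rename (copair (inl \o g) inr) phi).
rewrite sat_rename comp_copair; apply; congr (coheir U A _) : H.
by rewrite /plug !rename_comp; congr rename; apply/funext => -[].
Qed.

Section Ultra.
Variable U : set_system (MM -> MM).
Hypotheses (UU : UltraFilter U) (FU : F `<=` U).

Lemma U_retraction (phi : formula L MM) :
  sat (id : MM -> MM) phi -> U (retraction phi).
Proof. by move=> H; apply: FU; apply: (mf_sub FF); exists phi. Qed.

Lemma coheir_extends (V : Type) (A : V -> MM) : extends (coheir U A) A.
Proof.
move=> phi Aphi; have : sat (id : MM -> MM) (rename (copair A val) phi).
  by rewrite sat_rename.
move=> /U_retraction H; pose D := [set f : MM -> MM |
  sat (copair (f \o A) id) (plug phi val)].
apply: (@filterS _ U _ _ D _ H) => f [_ fid].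
rewrite /D /= sat_rename sat_plug; congr (sat _ _).
by apply/funext => -[//|m] /=; rewrite fid //; apply: set_valP.
Qed.

Lemma coheir_invariant (V : Type) (A : V -> MM) :
  invariant_type (coheir U A).
Proof.
split.
- move=> G fG GU.
  pose D phi := [set f : MM -> MM | sat (copair (f \o A) id) phi].
  have /(filter_finite (f := D) _ fG)/filter_ex[f Hf] :
    forall phi, G phi -> U (D phi) by [].
  by exists (f \o A).
- move=> phi; have [H|H] := in_ultra_setVsetC
    [set f : MM -> MM | sat (copair (f \o A) id) phi] UU; first by left.
  by right.
- move=> W phi b b' bb'.
  have : U (retraction (Not Bot)) by apply: U_retraction.
  move=> H UD; pose D d := [set f : MM -> MM |
    sat (copair (f \o A) id) (plug phi (copair d val))].
  apply: (@filterS _ U _ _ (D b') _ (filterI H (UD : U (D b)))).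
  move=> f [[fM _ _]]; rewrite /D /= !sat_plug.
  have /choice[m mE] : forall v, exists m : M, f (A v) = val m.
    by move=> v; exists (SigSub (mem_set (fM (A v)))).
  have E d : copair (f \o A) (copair d val) =
      copair d val \o copair (inr \o m) (@id (W + M)).
    by apply/funext => -[v|[]] //=; rewrite mE.
  by rewrite !E -!sat_rename => /bb'.
Qed.

(** A realization of an invariant type over [A] is in a position that
    [amalgamation] allows: realize the type over all the given conjugates of [A]
    at once, and use that the type of a realization is determined by that of the
    parameters. *)
Lemma invariant_amalgamation (V W : finType) (r : set (formula L (W + MM)))
    (A : V -> MM) (g : W -> V) (c : W -> MM) :
  invariant_type r -> realizes_over r c A -> eqtp c (A \o g) ->
  exists U', [/\ UltraFilter U', F `<=` U',
    push U' A = push U A & push U' c = push U (A \o g)].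
Proof.
move=> rI cA cg; apply: (amalgamation) => // l B BA.
have [c' c'B] := realize
  (fun x : 'I_l * V => B x.1 x.2) (it_consis rI).
have c'c := realizes_eqtp0 rI c'B cA.
have [s fs sA] := conjugate (eqtp_sym (eqtp_trans c'c cg)).
exists (s \o A); first exact: eqtp_fixes.
move=> i; have c'Bi := realizes_sub (g := fun v => (i, v)) c'B.
have := realizes_eqtp rI c'Bi cA (BA i).
move=> /(eqtp_comp (copair inr inl)); rewrite !comp_copair.
by rewrite -sA.
Qed.

End Ultra.

(** * Trees of finite height *)

Section Trees.
Variable m : nat.

(** The index set of a binary tree of height [n] of [m]-tuples: the left subtree,
    the right subtree and the root. *)
Fixpoint tree (n : nat) : finType :=
  if n is n'.+1 then ((tree n' + tree n') + 'I_m)%type else 'I_m.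

(** Only the words of length at most [n] name a vertex of their own. *)
Fixpoint node (n : nat) (eta : seq bool) : 'I_m -> tree n :=
  match n, eta return 'I_m -> tree n with
  | 0, _ => id
  | n'.+1, [::] => inr
  | n'.+1, false :: eta' => inl \o (inl \o node n' eta')
  | n'.+1, true :: eta' => inl \o (inr \o node n' eta')
  end.

(** The vertices of [A] named by a family of words, joined into one tuple of
    parameters. *)
Definition family (n : nat) (A : tree n -> MM) (W : Type)
    (w : W -> seq bool) (x : W * 'I_m) : MM :=
  A (node n (w x.1) x.2).

Variables (b : 'I_m -> MM) (r q : set (formula L ('I_m + MM))).

(** A vertex realizes [r] over what is above it, whence the paths are Morley
    sequences of [r]; a vertex to the right of a branching point realizes [q] over
    what is to the left of it, whence the descending combs are Morley sequences
    of [q]. *)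
Record good_tree (n : nat) (A : tree n -> MM) : Prop := GoodTree {
  gt_node : forall eta, size eta <= n -> eqtp (A \o node n eta) b;
  gt_path : forall eta (W : Type) (w : W -> seq bool), size eta <= n ->
    (forall i, [/\ prefix eta (w i), eta != w i & size (w i) <= n]) ->
    realizes_over r (A \o node n eta) (family A w);
  gt_comb : forall eta nu (W : Type) (w : W -> seq bool), size nu <= n ->
    prefix (rcons eta true) nu ->
    (forall i, prefix (rcons eta false) (w i) /\ size (w i) <= n) ->
    realizes_over q (A \o node n nu) (family A w) }.

Lemma good_tree_eqtp (n : nat) (A A' : tree n -> MM) :
  invariant_type r -> invariant_type q ->
  eqtp A A' -> good_tree A -> good_tree A'.
Proof.
move=> rI qI AA' [E P C].
have T (W : Type) (w : W -> seq bool) eta :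
    eqtp (copair (A \o node n eta) (family A w))
      (copair (A' \o node n eta) (family A' w)).
  have := eqtp_comp (copair (node n eta) (fun x => node n (w x.1) x.2)) AA'.
  by rewrite !comp_copair.
split=> [eta|eta W w Hn Hw|eta nu W w Hn Hp Hw].
- move=> /E; apply: eqtp_trans; apply: eqtp_sym; exact: eqtp_comp.
- exact: (realizes_transfer rI (T _ _ _) (P _ _ _ Hn Hw)).
- exact: (realizes_transfer qI (T _ _ _) (C _ _ _ _ Hn Hp Hw)).
Qed.

(** One step up in height: [A] on the left, its conjugate [A1] on the right and the
    root [c] below both. *)
Lemma good_tree_graft (n : nat) (A A1 : tree n -> MM) (c : 'I_m -> MM) :
  invariant_type r -> invariant_type q ->
  good_tree A -> eqtp A A1 -> eqtp c b ->
  (forall eta, size eta <= n -> realizes_over q (A1 \o node n eta) A) ->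
  realizes_over r c (copair A A1) ->
  good_tree (copair (copair A A1) c : tree n.+1 -> MM).
Proof.
move=> rI qI gA AA1 cb A1q cr.
have gA1 := good_tree_eqtp rI qI AA1 gA.
pose A3 : tree n.+1 -> MM := copair (copair A A1) c.
(* words with the same first letter live in one of the two subtrees *)
have famE (W : Type) (w : W -> seq bool) (d : bool) :
    (forall i, w i = d :: behead (w i)) ->
    family A3 w = family (if d then A1 else A) (behead \o w).
  move=> Hw; apply/funext => -[i j]; rewrite /family /= Hw /=.
  by case: d Hw.
split.
- move=> [_|[] eta Hn] /=; first exact: cb.
    exact: (gt_node gA1).
  exact: (gt_node gA).
- move=> [|d eta] W w Hn Hw.
    pose k (x : W * 'I_m) : tree n + tree n := match w x.1 with
      | true :: nu => inr (node n nu x.2)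
      | false :: nu => inl (node n nu x.2)
      | [::] => inl (node n [::] x.2) end.
    have := realizes_sub (g := k) cr.
    congr realizes_over; apply/funext => -[i j]; rewrite /family /k /=.
    by have [_ + _] := Hw i; case: (w i) => [|[] nu].
  have Hw1 i : w i = d :: behead (w i).
    by have [+ _ _] := Hw i; case: (w i) => [|d' nu] //= /andP[/eqP->].
  rewrite (famE _ _ _ Hw1).
  have Hw2 i : [/\ prefix eta (behead (w i)), eta != behead (w i)
      & size (behead (w i)) <= n].
    have [] := Hw i; rewrite Hw1 /= eqxx /= => p ne s; split=> //.
    by apply: contra ne => /eqP <-.
  case: (d) => /=.
    exact: (gt_path gA1 Hn Hw2).
  exact: (gt_path gA Hn Hw2).
- move=> [|d eta] [|d' nu] W w Hn //= Hp Hw.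
    have -> : d' = true by case: (d') Hp.
    have Hw1 i : w i = false :: behead (w i).
      by have [+ _] := Hw i; case: (w i) => [|[] mu].
    rewrite (famE _ _ _ Hw1) /=.
    have := realizes_sub (g := fun x : W * 'I_m =>
      node n (behead (w x.1)) x.2) (A1q nu Hn).
    by [].
  case/andP: Hp => /eqP dd' Hp; rewrite -{}dd'.
  have Hw1 i : w i = d :: behead (w i).
    by have [+ _] := Hw i; case: (w i) => [|d2 mu] //= /andP[/eqP->].
  rewrite (famE _ _ _ Hw1).
  have Hw2 i : prefix (rcons eta false) (behead (w i)) /\
      size (behead (w i)) <= n.
    by have [] := Hw i; rewrite Hw1 /= eqxx.
  case: (d) => /=.
    exact: (gt_comb gA1 Hn Hp Hw2).
  exact: (gt_comb gA Hn Hp Hw2).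
Qed.

End Trees.

Variable U0 : set_system (MM -> MM).
Hypotheses (UU0 : UltraFilter U0) (FU0 : F `<=` U0).

(** The induction carries an ultrafilter of the flow that gives all vertices the
    coheir [q] that [U0] gives to [b].  If [A1] realizes the coheir of [A] over
    [A], its vertices realize [q] over [A]; [invariant_amalgamation] restores the
    common coheir, once for [A1] and once for the new root. *)
Theorem good_tree_exists (m : nat) (b : 'I_m -> MM)
    (r : set (formula L ('I_m + MM))) (n : nat) :
  invariant_type r -> extends r b ->
  exists A : tree m n -> MM, good_tree b r (coheir U0 b) A.
Proof.
move=> rI rb; have qI := coheir_invariant UU0 FU0 b.
suff [U [A [UU FU UA gA]]] : exists U (A : tree m n -> MM),
    [/\ UltraFilter U, F `<=` U,
      forall eta, size eta <= n -> push U (A \o node n eta) = push U0 b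
      & good_tree b r (coheir U0 b) A] by exists A.
elim: n => [|n [U [A [UU FU UA gA]]]].
  have s0 (eta : seq bool) : size eta <= 0 -> eta = [::] by case: eta.
  exists U0, b; split=> //; split=> //.
    move=> eta W w /s0 -> Hw; apply: (realizes_empty _ rI rb) => // -[i _].
    by have [_ + /s0 wi] := Hw i; rewrite wi.
  by move=> eta nu W w /s0 -> /=; case: eta.
have [A1 A1q] := realize A (it_consis (coheir_invariant UU FU A)).
have A1A : eqtp A1 A by apply: extends_eqtp A1q; exact: (coheir_extends UU FU).
have [U1 [UU1 FU1 U1A U1A1]] := invariant_amalgamation UU FU (g := id)
  (coheir_invariant UU FU A) A1q A1A.
have [c cr] := realize (copair A A1) (it_consis rI).
have cb : eqtp c b by apply: extends_eqtp cr.
have cg : eqtp c (copair A A1 \o (inl \o node n [::])).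
  exact: eqtp_trans cb (eqtp_sym (gt_node gA (eta := [::]) (leq0n n))).
have [U2 [UU2 FU2 U2A U2c]] := invariant_amalgamation UU1 FU1 rI cr cg.
exists U2, (copair (copair A A1) c); split; [exact: UU2|exact: FU2| |].
  have E1 eta (Hn : size eta <= n) D :
      push U1 (A \o node n eta) D = push U0 b D.
    transitivity (push U (A \o node n eta) D); last by rewrite (UA eta Hn).
    exact: (congr1 (fun P => P [set v : tree m n -> MM |
      D (v \o node n eta)]) U1A).
  have E2 eta (Hn : size eta <= n) D :
      push U1 (A1 \o node n eta) D = push U0 b D.
    transitivity (push U (A \o node n eta) D); last by rewrite (UA eta Hn).
    exact: (congr1 (fun P => P [set v : tree m n -> MM |
      D (v \o node n eta)]) U1A1).
  move=> [|d eta] Hn; apply/funext => D.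
    transitivity (push U1 (A \o node n [::]) D); last exact: (E1 [::]).
    exact: (congr1 (fun P => P D) U2c).
  case: d Hn => Hn.
    transitivity (push U1 (A1 \o node n eta) D); last exact: E2.
    exact: (congr1 (fun P => P [set v : tree m n + tree m n -> MM |
      D (v \o (inr \o node n eta))]) U2A).
  transitivity (push U1 (A \o node n eta) D); last exact: E1.
  exact: (congr1 (fun P => P [set v : tree m n + tree m n -> MM |
      D (v \o (inl \o node n eta))]) U2A).
apply: good_tree_graft rI qI gA (eqtp_sym A1A) cb _ cr.
move=> eta Hn; have := coheir_realizes_comp (g := node n eta) A1q.
by rewrite /coheir UA.
Qed.

(** * Morley sequences *)

Section Morley.
Variables (V : finType) (p : set (formula L (V + MM))).

Definition morley (c : nat -> V -> MM) (k : nat) : Prop :=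
  forall i, i < k -> realizes_over p (c i) (fun x : 'I_i * V => c x.1 x.2).

(** Morley sequences of the same type and length have the same type over [M]. *)
Lemma morley_eqtp (c c' : nat -> V -> MM) (k : nat) : invariant_type p ->
  morley c k -> morley c' k ->
  eqtp (fun x : 'I_k * V => c x.1 x.2) (fun x => c' x.1 x.2).
Proof.
move=> pI; elim: k => [|k IH] ck c'k.
  pose z (x : 'I_0 * V) : void := match notF (ltn_ord x.1) with end.
  have E (d : nat -> V -> MM) :
      (fun x : 'I_0 * V => d x.1 x.2) = of_void MM \o z.
    by apply/funext => -[[]].
  by rewrite !E; apply: eqtp_comp => phi.
have := realizes_eqtp pI (ck k (ltnSn k)) (c'k k (ltnSn k)).
have /[swap]/[apply] : eqtp (fun x : 'I_k * V => c x.1 x.2)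
    (fun x => c' x.1 x.2).
  by apply: IH => i ik; [apply: ck|apply: c'k]; exact: ltnW.
pose h (x : 'I_k.+1 * V) : V + 'I_k * V :=
  if unlift ord_max x.1 is Some j then inr (j, x.2) else inl x.2.
have E (d : nat -> V -> MM) : (fun x : 'I_k.+1 * V => d x.1 x.2) =
    copair (d k) (fun x : 'I_k * V => d x.1 x.2) \o h.
  apply/funext => -[i j]; rewrite /h /=.
  by case: unliftP => [i' ->|->] //=; rewrite /bump leqNgt ltn_ord.
by move=> /(eqtp_comp h); rewrite -!E.
Qed.

Lemma morley_sub (c : nat -> V -> MM) (N k : nat) (t : nat -> nat) :
  (forall i j, i < j -> j < k -> t i < t j) -> (forall i, i < k -> t i < N) ->
  morley c N -> morley (c \o t) k.
Proof.
move=> tlt tN cN i ik.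
pose g (x : 'I_i * V) : 'I_(t i) * V :=
  (Ordinal (tlt _ _ (ltn_ord x.1) ik), x.2).
exact: (realizes_sub (g := g) (cN _ (tN _ ik))).
Qed.

Variables (n : nat) (psi : formula L ('I_n + (V + M))).

Definition consistent_along (c : nat -> V -> MM) (k : nat) : Prop :=
  exists x, forall i, i < k -> sat (copair x (copair (c i) val)) psi.

Lemma morley_consistent (c c' : nat -> V -> MM) (k : nat) :
  invariant_type p -> morley c k -> morley c' k ->
  consistent_along c k -> consistent_along c' k.
Proof.
move=> pI ck c'k [x Hx].
have [s fs sE] := conjugate (morley_eqtp pI ck c'k).
exists (s \o x) => i ik.
have -> : c' i = s \o c i.
  by apply/funext => j; have := congr1 (@^~ (Ordinal ik, j)) sE.
rewrite (copair_fixes _ fs) -comp_copair.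
by have [sa _] := fs; apply/(sat_automorphism sa); exact: Hx.
Qed.

End Morley.

Section TreeMorley.
Variables (m : nat) (b : 'I_m -> MM) (r q : set (formula L ('I_m + MM))).
Variables (N : nat) (A : tree m N -> MM).
Hypotheses (gA : good_tree b r q A).

(** In a descending comb all words before a given one branch off from it at the
    same place and to the left. *)
Lemma comb_morley (l : nat) (c : 'I_l.+1 -> seq bool) :
  invariant_type q -> extends q b ->
  descending_comb c -> (forall i, size (c i) <= N) ->
  morley q (fun i => A \o node N (c (inord i))) l.+1.
Proof.
move=> qI qb [inc lex meet] cN [|i] il.
  apply: (realizes_empty _ qI qb); first by move=> [[]].
  by apply: (gt_node gA); exact: cN.
have ltord (j : 'I_i.+1) : (inord j : 'I_l.+1) < (inord i.+1 : 'I_l.+1).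
  by rewrite !inordK // (ltn_trans (ltn_ord j)).
pose eta := wmeet (c (inord 0)) (c (inord i.+1)).
have etaE (j : 'I_i.+1) : eta = wmeet (c (inord j)) (c (inord i.+1)).
  rewrite /eta; case: j => -[|j] ji //=.
  apply: meet; last exact: (ltord (Ordinal ji)).
  by rewrite !inordK // (ltn_trans ji).
have H (j : 'I_i.+1) : prefix (rcons eta false) (c (inord j)) /\
    prefix (rcons eta true) (c (inord i.+1)).
  rewrite (etaE j); apply: wlex_wmeet; last exact: lex.
  by apply: inc; rewrite -val_eqE /= ltn_eqF.
apply: (gt_comb gA (eta := eta) (w := fun j : 'I_i.+1 => c (inord j))) => //.
  exact: (H ord0).2.
by move=> j; split=> //; exact: (H j).1.
Qed.

Lemma path_morley (eta : nat -> bool) (k : nat) (t : nat -> nat) :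
  (forall i j, i < j -> j < k -> t j < t i) -> (forall i, i < k -> t i <= N) ->
  morley r (fun i => A \o node N (mkseq eta (t i))) k.
Proof.
move=> tlt tN i ik.
apply: (gt_path gA (w := fun j : 'I_i => mkseq eta (t j))).
  by rewrite size_mkseq tN.
move=> j; have [p1 p2] := prefix_mkseq eta (tlt _ _ (ltn_ord j) ik).
by split=> //; rewrite size_mkseq tN // (ltn_trans (ltn_ord j)).
Qed.

End TreeMorley.

(** * Limits of countable tuples *)

Section Limit.
Variable U : set_system nat.
Hypothesis UU : UltraFilter U.
Variable v : nat -> nat -> MM.

(** [y] continues the first [n] coordinates of the ultraproduct of the [v N]. *)
Definition limit_of (n : nat) (y : 'I_n -> MM) : Prop :=
  forall phi : formula L 'I_n,
    U [set N | sat (fun i : 'I_n => v N i) phi] -> sat y phi.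

Lemma limit_step (n : nat) (y : 'I_n -> MM) : limit_of y ->
  exists x, limit_of (fun i : 'I_n.+1 =>
    if unlift ord_max i is Some j then y j else x).
Proof.
move=> yv; pose w N := copair (fun _ : 'I_1 => v N n) (fun i : 'I_n => v N i).
pose p := [set chi | exists2 phi : formula L ('I_1 + 'I_n),
  chi = plug phi y & U [set N | sat (w N) phi]].
have pc : consis p.
  move=> G /finite_set_enum[k [g ->]] gp.
  have /choice[phi phiP] i : exists phi : formula L ('I_1 + 'I_n),
      g i = plug phi y /\ U [set N | sat (w N) phi].
    by have [phi] := gp (g i) (ex_intro2 _ _ i Logic.I erefl); exists phi.
  have [Phi PhiE] := conj_ex phi; have [Psi PsiE] := exists_block Phi.
  have /yv/PsiE[c Hc] : U [set N | sat (fun i : 'I_n => v N i) Psi].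
    have /filter_forall : forall i, U [set N | sat (w N) (phi i)].
      by move=> i; case: (phiP i).
    apply: filterS => N HN; apply/PsiE; exists (fun=> v N n); exact/PhiE.
  exists c => _ [i _ <-]; have [-> _] := phiP i.
  by rewrite sat_plug; move/PhiE: Hc.
have [c cy] := realize y pc.
exists (c ord0) => phi Uphi.
pose h (i : 'I_n.+1) : 'I_1 + 'I_n :=
  if unlift ord_max i is Some j then inr j else inl ord0.
have := cy (rename (copair inl (inr \o inl)) (rename h phi)).
have -> : plug (rename (copair inl (inr \o inl)) (rename h phi))
    (copair y (val : M -> MM)) = plug (rename h phi) y.
  by rewrite /plug !rename_comp; congr rename; apply/funext => i /=;
    case: (h i).
rewrite !sat_rename => H; have : p (plug (rename h phi) y).
  exists (rename h phi) => //; apply: filterS Uphi => N /=.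
  rewrite sat_rename; congr (sat _ _); apply/funext => i /=; rewrite /h.
  by case: unliftP => [j ->|->] //=; rewrite /bump leqNgt ltn_ord.
move=> /H; congr (sat _ _); apply/funext => i /=; rewrite /h.
by case: unliftP.
Qed.

Lemma limit_nat : exists y : nat -> MM, forall phi : formula L nat,
  U [set N | sat (v N) phi] -> sat y phi.
Proof.
have [x0 _] : exists x : MM, True by case: (point_dom MM) => x; exists x.
pose good (s : seq MM) := limit_of (fun i : 'I_(size s) => nth x0 s i).
have g0 : good [::].
  move=> phi Uphi; have [N HN] := filter_ex Uphi.
  by congr (sat _ _) : HN; apply/funext => -[].
have next (s : {s | good s}) : {x | good (rcons (sval s) x)}.
  case: s => s gs; apply: cid; have [x Hx] := limit_step gs.
  exists x; rewrite /good /=.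
  have E := size_rcons s x.
  move=> phi Uphi; have := Hx (rename (cast_ord E) phi).
  rewrite sat_rename => H.
  have : U [set N | sat (fun i : 'I_(size s).+1 => v N i)
      (rename (cast_ord E) phi)].
    by apply: filterS Uphi => N; rewrite /= sat_rename.
  move=> /H; congr (sat _ _); apply/funext => i /=; rewrite nth_rcons.
  case: unliftP => [j /(congr1 val)|/(congr1 val)] /=.
    by rewrite /bump leqNgt ltn_ord /= add0n => ->; rewrite ltn_ord.
  by move=> ->; rewrite ltnn eqxx.
pose st n := iter n (fun s : {s | good s} => exist good _ (svalP (next s)))
  (exist good [::] g0).
pose y n := nth x0 (sval (st n.+1)) n.
have sz n : size (sval (st n)) = n.
  by elim: n => [//|n IH] /=; rewrite size_rcons IH.
have yE n i : i < n -> nth x0 (sval (st n)) i = y i.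
  elim: n => [//|n IH]; rewrite ltnS leq_eqVlt => /orP[/eqP->//|ilt].
  by rewrite /= nth_rcons sz ilt IH.
exists y => phi Uphi; have [n [w [psi phiE]]] := rename_support phi.
pose k := (\max_(i < n) w i).+1.
have wk i : w i < size (sval (st k)) by rewrite sz ltnS leq_bigmax.
have := svalP (st k); rewrite -/(good _) => gk.
have := gk (rename (fun i => Ordinal (wk i)) psi).
rewrite phiE !sat_rename => H; have : U [set N |
    sat (fun i : 'I_(size (sval (st k))) => v N i)
      (rename (fun i => Ordinal (wk i)) psi)].
  by apply: filterS Uphi => N; rewrite /= phiE !sat_rename.
move=> /H; congr (sat _ _); apply/funext => i /=.
by rewrite -[LHS]/(nth x0 (sval (st k)) (w i)) yE // -[X in _ < X]sz.
Qed.

End Limit.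

(** Saturation for countably many variables: a sequence of tuples has a limit
    that satisfies every formula true of almost all of them. *)
Lemma limit_countable (X : countType) (v : nat -> X -> MM) :
  exists y : X -> MM, forall phi : formula L X,
    (exists N0, forall N, N0 <= N -> sat (v N) phi) -> sat y phi.
Proof.
have [U [UU EU]] := ultraFilterLemma (eventually_filter : ProperFilter \oo).
have [x0 _] : exists x : MM, True by case: (point_dom MM) => x; exists x.
pose v' N k := if unpickle k is Some x then v N x else x0.
have [y Hy] := limit_nat UU v'.
exists (y \o pickle) => phi [N0 HN0]; rewrite -sat_rename; apply: Hy.
apply: EU; exists N0 => // N /= /HN0; rewrite sat_rename.
by congr (sat _ _); apply/funext => x /=; rewrite /v' pickleK.
Qed.

(** * From trees to DCTP2 *)

Lemma consistent_range (n l : nat) (f : 'I_l -> formula L ('I_n + MM)) :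
  consistent (range f) <->
  exists x : 'I_n -> MM, forall i, sat (copair x id) (f i).
Proof.
split=> [H|[x Hx] G _ Gf].
  have [||x Hx] := H (range f).
  - exact: finite_image.
  - by [].
  - by exists x => i; apply: Hx; exists i.
by exists x => _ /Gf[i _ <-]; apply: Hx.
Qed.

(** Finite trees of all heights give an infinite one by compactness.  DCTP2 asks for
    a formula without parameters, so those of [psi] are appended to the tuples of
    the tree. *)
Lemma DCTP2_of_trees (n m k : nat) (psi : formula L ('I_n + ('I_m + M)))
    (a : nat -> seq bool -> 'I_m -> MM) :
  (forall N l (c : 'I_l.+1 -> seq bool), descending_comb c ->
    (forall i, size (c i) <= N) ->
    exists x, forall i, sat (copair x (copair (a N (c i)) val)) psi) ->
  (forall N (eta : nat -> bool) (j : 'I_k -> nat), injective j ->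
    (forall i, j i <= N) ->
    ~ exists x, forall i,
      sat (copair x (copair (a N (mkseq eta (j i))) val)) psi) ->
  exists m' (phi : formula L ('I_n + 'I_m')), has_DCTP2 MM k phi.
Proof.
move=> combs paths.
have [l [u [chi psiE]]] := rename_support psi.
have [m0 _] := submodel_point.
pose h (i : 'I_l) : 'I_n + 'I_(m + l) := match u i with
  | inl x => inl x | inr (inl y) => inr (lshift l y)
  | inr (inr _) => inr (rshift m i) end.
pose phi := rename h chi.
(* the last l coordinates list the parameters of psi, with the default m0 at the
   places where u names a variable *)
pose e N eta (z : 'I_(m + l)) : MM := match fintype.split z with
  | inl y => a N eta y
  | inr i => if u i is inr (inr d) then val d else m0 end.
have eE N eta x : sat (copair x (e N eta)) phi <->
    sat (copair x (copair (a N eta) val)) psi.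
  rewrite psiE /phi !sat_rename.
  suff -> : copair x (e N eta) \o h = copair x (copair (a N eta) val) \o u.
    by [].
  apply/funext => i; rewrite /= /h.
  case ui: (u i) => [y|[y|y]] //=; rewrite /e.
    by rewrite -[lshift _ _]/(unsplit (inl y)) unsplitK.
  by rewrite -[rshift _ _]/(unsplit (inr i)) unsplitK ui.
have [w Hw] := limit_countable (fun N
  (x : seq bool * 'I_(m + l)) => e N x.1 x.2).
exists (m + l), phi, (fun eta z => w (eta, z)).
(* that phi has a common solution at given vertices is a formula on the tree *)
have joint l' (c : 'I_l' -> seq bool) :
    exists Psi : formula L (seq bool * 'I_(m + l)),
    forall v : seq bool * 'I_(m + l) -> MM,
    sat v Psi <-> exists x, forall i,
      sat (copair x (fun z => v (c i, z))) phi.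
  have [Phi PhiE] := conj_ex (fun i =>
    rename (copair inl (inr \o pair (c i))) phi).
  have [Psi PsiE] := exists_block Phi; exists Psi => v.
  rewrite PsiE; split=> -[x Hx]; exists x.
    by move=> i; have /PhiE/(_ i) := Hx; rewrite sat_rename comp_copair.
  by apply/PhiE => i; rewrite sat_rename comp_copair; exact: Hx.
split.
  move=> l' c cc; have [Psi PsiE] := joint _ c.
  have /Hw/PsiE[x Hx] : exists N0, forall N, N0 <= N ->
      sat (fun x : seq bool * 'I_(m + l) => e N x.1 x.2) Psi.
    exists (\max_(i < l'.+1) size (c i)) => N HN; apply/PsiE.
    have [i|x Hx] := combs N l' c cc; first exact: leq_trans (leq_bigmax i) HN.
    by exists x => i; apply/eE.
  by apply/consistent_range; exists x => i; rewrite sat_plug.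
move=> eta j jinj /consistent_range[x Hx].
have [Psi PsiE] := joint _ (fun i => mkseq eta (j i)).
have /Hw : exists N0, forall N, N0 <= N ->
    sat (fun x : seq bool * 'I_(m + l) => e N x.1 x.2) (Not Psi).
  exists (\max_(i < k) j i) => N HN /PsiE[y Hy].
  apply: (paths N eta j jinj) => [i|]; first exact: leq_trans (leq_bigmax i) HN.
  by exists y => i; apply/eE; exact: Hy.
move=> nPsi; apply: nPsi; apply/PsiE; exists x => i.
by have := Hx i; rewrite sat_plug.
Qed.

(** The coheirs given by [U0] witness Kim-dividing along any invariant type: if [psi]
    were consistent along [coheir U0 b], the good trees would give it DCTP2. *)
Theorem coheir_witness (n m k : nat) (psi : formula L ('I_n + ('I_m + M)))
    (b : 'I_m -> MM) (r : set (formula L ('I_m + MM))) (c0 : nat -> 'I_m -> MM) :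
  N_omega_DCTP2 MM -> invariant_type r -> extends r b ->
  morley r c0 k -> ~ consistent_along psi c0 k ->
  exists k', forall c, morley (coheir U0 b) c k' ->
    ~ consistent_along psi c k'.
Proof.
move=> nd rI rb c0k c0N; pose q := coheir U0 b; apply: contrapT => NN.
have qI : invariant_type q := coheir_invariant UU0 FU0 b.
have qb : extends q b := coheir_extends UU0 FU0 (A := b).
have qcons k' c : morley q c k' -> consistent_along psi c k'.
  move=> ck; apply: contrapT => N; apply: NN; exists k' => c' c'k c'C; apply: N.
  exact: (morley_consistent qI c'k ck c'C).
have /choice[a aP] N : exists a : seq bool -> 'I_m -> MM,
    (forall l (c : 'I_l.+1 -> seq bool), descending_comb c ->
      (forall i, size (c i) <= N) -> morley q (fun i => a (c (inord i))) l.+1) /\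
    (forall eta t, (forall i j, i < j -> j < k -> t j < t i) ->
      (forall i, i < k -> t i <= N) -> morley r (fun i => a (mkseq eta (t i))) k).
  have [A gA] := good_tree_exists N rI rb.
  exists (fun eta => A \o node N eta); split.
    by move=> l c cc cN; exact: (comb_morley gA qI qb cc cN).
  by move=> eta t tlt tN; exact: (path_morley gA (eta := eta) tlt tN).
have [||m' [phi Hphi]] := @DCTP2_of_trees n m k psi a; last exact: nd Hphi.
- move=> N l c cc cN; have [cP _] := aP N.
  have [x Hx] := qcons _ _ (cP l c cc cN); exists x => i.
  by have := Hx i (ltn_ord i); rewrite inord_val.
- move=> N eta j jinj jN [x Hx].
  have [t [tlt tj]] := decreasing_enum jinj.
  have tN i : i < k -> t i <= N by move=> /tj[y ->].
  have [_ /(_ eta t tlt tN) ak] := aP N.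
  apply: c0N; apply: (morley_consistent rI ak c0k).
  by exists x => i /tj[y ->].
Qed.

(** * Kim-dividing and Kim-forking *)

Lemma morley_exists (V : finType) (p : set (formula L (V + MM))) :
  invariant_type p -> exists c, forall k, morley p c k.
Proof.
move=> pI.
have [x0 _] : exists x : MM, True by case: (point_dom MM) => x; exists x.
have /choice[next nextP] (s : seq (V -> MM)) : exists d : V -> MM,
    realizes_over p d
      (fun x : 'I_(size s) * V => nth (fun=> x0) s x.1 x.2).
  exact: (realize _ (it_consis pI)).
pose st n := iter n (fun s => rcons s (next s)) [::].
pose c n := nth (fun=> x0) (st n.+1) n.
have sz n : size (st n) = n.
  by elim: n => [//|n IH]; rewrite /st iterS -/(st n) size_rcons IH.
have cE n i : i < n -> nth (fun=> x0) (st n) i = c i.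
  elim: n => [//|n IH]; rewrite ltnS leq_eqVlt => /orP[/eqP->//|ilt].
  by rewrite /st iterS -/(st n) nth_rcons sz ilt IH.
exists c => k i _.
have -> : c i = next (st i).
  by rewrite /c /st iterS -/(st i) nth_rcons sz ltnn eqxx.
pose g (x : 'I_i * V) : 'I_(size (st i)) * V := (cast_ord (esym (sz i)) x.1, x.2).
have := realizes_sub (g := g) (nextP (st i)).
congr realizes_over; apply/funext => -[j v] /=.
by rewrite cE.
Qed.

Lemma Kim_divides_coheir (n : nat) (phi : pformula M n) :
  N_omega_DCTP2 MM -> Kim_divides phi ->
  exists k, forall c, morley (coheir U0 (@pf_tuple _ _ _ _ phi)) c k ->
    ~ consistent_along (pf_form phi) c k.
Proof.
case: phi => m psi b nd kd /=.
have [s [[p [pg pI pb ps]] sN]] : exists s : nat -> 'I_m -> MM,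
  invariant_morley M b s /\
  ~ consistent (range (fun i => inst psi (copair (s i) val))) := kd.
have rI := invariant_type_of pg pI.
have rb : extends p b by move=> phi; exact: pb.
have sM' k : morley p s k.
  move=> i _ phi pphi.
  pose D := M `|` [set s jl.1 jl.2 | jl in [set jl : nat * 'I_m | jl.1 < i]].
  have Dw (x : 'I_i * 'I_m + M) :
      D (copair (fun x : 'I_i * 'I_m => s x.1 x.2) val x).
    case: x => [[j l]|d]; last by left; apply: set_valP.
    by right; exists (val j, l) => /=.
  pose d x : D := SigSub (mem_set (Dw x)).
  have := ps i (rename (copair inl (inr \o d)) phi).
  rewrite sat_rename comp_copair; apply.
  rewrite /restrict /=; congr (p _) : pphi.
  by rewrite /inst /plug !rename_comp; congr rename; apply/funext => -[|[]].
have [k sk] : exists k, ~ consistent_along psi s k.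
  apply: contrapT => N; apply: sN => G fG Gf.
  have [l [g GE]] := finite_set_enum fG.
  have /choice[t tE] (i : 'I_l) :
      exists j, g i = inst psi (copair (s j) val).
    have [|j _ <-] := Gf (g i); first by rewrite GE; exists i.
    by exists j.
  have [x Hx] : consistent_along psi s (\max_i t i).+1.
    by apply: contrapT => N'; apply: N; exists (\max_i t i).+1.
  exists x; rewrite GE => _ [i _ <-]; rewrite tE sat_plug; apply: Hx.
  by rewrite ltnS leq_bigmax.
exact: (coheir_witness nd rI rb (sM' k) sk).
Qed.

Lemma Kim_divides_of_coheir (n m : nat) (psi : formula L ('I_n + ('I_m + M)))
    (b : 'I_m -> MM) (s : nat -> 'I_m -> MM) k :
  (forall k, morley (coheir U0 b) s k) -> ~ consistent_along psi s k ->
  Kim_divides (@PFormula L MM M n m psi b).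
Proof.
move=> sM' sk; have qI := coheir_invariant UU0 FU0 b.
exists s; split; last first.
  move=> H; apply: sk.
  have [||x Hx] := H (range (fun i : 'I_k => inst psi (copair (s i) val))).
  - exact: finite_image.
  - by move=> _ [i _ <-]; exists (val i).
  exists x => i ik; have := Hx _ (ex_intro2 _ _ (Ordinal ik) Logic.I erefl).
  by rewrite sat_plug.
exists (coheir U0 b); split.
- by split; [exact: (it_consis qI)|exact: (it_total qI)].
- move=> w phi c c' /eqtp_tp cc'; split; apply: (it_invariant qI) => //.
  exact: eqtp_sym.
- exact: (coheir_extends UU0 FU0 (A := b)).
- move=> i phi pphi.
  pose B (x : 'I_i * 'I_m) := s x.1 x.2.
  pose D := M `|` [set s jl.1 jl.2 | jl in [set jl : nat * 'I_m | jl.1 < i]].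
  have /choice[d dE] (y : D) : exists x, copair B (val : M -> MM) x = val y.
    have [My|[[j l] /= ji <-]] := set_valP y.
      by exists (inr (SigSub (mem_set My))).
    by exists (inl (Ordinal ji, l)).
  have E : copair B (val : M -> MM) \o d = val by apply/funext.
  have := sM' i.+1 i (ltnSn i) (rename (copair inl (inr \o d)) phi).
  rewrite sat_rename comp_copair -/B.
  have -> : copair (s i) (copair B (val : M -> MM)) \o (inr \o d) = val.
    by rewrite -E.
  apply; rewrite /restrict /= in pphi; congr (coheir U0 b _) : pphi.
  rewrite /inst /plug rename_comp; congr rename; apply/funext => -[v|y] //=.
  by rewrite dE.
Qed.

(** A single Morley sequence of the coheir of all the parameters restricts to a
    Morley sequence of the coheir of each of them, because these coheirs are given
    by the same ultrafilter.  A solution of [phi] along sufficiently many terms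
    solves one of the [psi i] along more terms than consistency allows. *)
Theorem Kim_forks_divides (n : nat) (phi : pformula M n) :
  N_omega_DCTP2 MM -> Kim_forks phi -> Kim_divides phi.
Proof.
move=> nd [d [psi [phipsi psiK]]].
have /choice[k kP] i := Kim_divides_coheir nd (psiK i).
case: phi phipsi => m phi a phipsi.
pose J := {i : 'I_d & 'I_(pf_arity (psi i))}.
pose b (x : 'I_m + J) : MM :=
  copair a (fun y : J => @pf_tuple _ _ _ _ (psi (tag y)) (tagged y)) x.
have qI := coheir_invariant UU0 FU0 b.
have [B BM] := morley_exists qI.
have Bsub (V : finType) (g : V -> 'I_m + J) l :
    morley (coheir U0 (b \o g)) (fun i => B i \o g) l.
  move=> i il; have := coheir_realizes_comp (g := g) (BM l i il).
  exact: (realizes_sub (g := fun x : 'I_i * V => (x.1, g x.2))).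
apply: (@Kim_divides_of_coheir n m phi a (fun i => B i \o inl)
  (\sum_i k i).+1) => [l|]; first exact: Bsub.
move=> [c Hc].
have /choice[col colP] (j : 'I_(\sum_i k i).+1) : exists i, sat
    (copair c (copair (B j \o (inr \o Tagged (fun i => 'I_(pf_arity (psi i)))))
      val)) (pf_form (psi i)).
  have Bj : eqtp b (B j).
    apply: eqtp_sym; apply: extends_eqtp (BM _ _ (ltn_ord j)).
    exact: (coheir_extends UU0 FU0 (A := b)).
  (* the implication from phi to the psi i is moved to the j-th term by an
     automorphism *)
  have [s fs sb] := conjugate Bj.
  have [[s' sK s'K] _ _] := fs.1.
  have E : s \o (s' \o c) = c by apply/funext => x /=; rewrite s'K.
  have : psat (s' \o c) (PFormula phi a).
    rewrite /psat /=; apply/(sat_automorphism fs.1).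
    rewrite comp_copair -(copair_fixes _ fs) E.
    have -> : s \o a = B j \o inl by rewrite -sb; apply/funext.
    exact: Hc.
  move=> /phipsi[i Hi]; exists i.
  move: Hi; rewrite /psat -(sat_automorphism fs.1).
  rewrite comp_copair -(copair_fixes _ fs) E.
  congr (sat (copair c (copair _ val)) _).
  by rewrite -sb; apply/funext.
have [i [t [tlt tz]]] := pigeonhole col (ltnSn _).
apply: (kP i (fun j => B (t j) \o (inr \o
  Tagged (fun i => 'I_(pf_arity (psi i)))))).
  have tN x : x < k i -> t x < (\sum_i k i).+1 by move=> /tz[z -> _].
  exact: (morley_sub tlt tN (Bsub _ _ _)).
exists c => x /tz[z tzx colz]; rewrite tzx.
by have := colP z; rewrite colz.
Qed.

End Monster.

Theorem mainTheorem7 (L : language) (T : theory L) (K : Type)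
    (MM : structure L) :
  complete_theory T -> monster K T MM -> N_omega_DCTP2 MM ->
  forall M : set MM, small K M -> elementary_submodel M ->
  forall (n : nat) (phi : pformula M n), Kim_forks phi <-> Kim_divides phi.
Proof.
move=> _ [KP _ _ satu homo] nd M sM elM n phi; split; last first.
  by move=> phiK; exists 1, (fun=> phi); split=> // c; exists ord0.
have [F FF] := minimal_flow_exists elM.
have [U [UU FU]] := ultraFilterLemma (mf_proper FF).
exact: (Kim_forks_divides KP satu homo sM elM FF UU FU nd).
Qed.
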